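(* For any prime $p\ge 5$, \[ \sum_{k=0}^{p-1}\frac{3k+1}{(-32)^k}\,\mathrm{Domb}(k)\equiv (-1)^{\frac{p-1}{2}}p+p^3E_{p-3}\pmod{p^4}. \]
   Context: The Domb numbers are $\mathrm{Domb}(n)=\sum_{k=0}^n\binom{n}{k}^2\binom{2k}{k}\binom{2n-2k}{n-k}$. The Euler numbers $E_n$ are defined by $\frac{2}{e^x+e^{-x}}=\sum_{n\ge0}E_n\frac{x^n}{n!}$. Congruences between rational numbers whose denominators are prime to $p$ are understood in the ring of $p$-integral rationals. *)

(* Defs.v *)
From mathcomp Require Import all_boot all_order all_algebra.

Set Implicit Arguments.
Unset Strict Implicit.
Unset Printing Implicit Defensive.

Import Order.TTheory GRing.Theory Num.Theory.

Definition Domb (n : nat) : nat :=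
  (\sum_(k < n.+1) 'C(n, k) ^ 2 * 'C(2 * k, k) * 'C(2 * n - 2 * k, n - k))%N.

Local Open Scope ring_scope.

(* A formal power series over the rationals is its sequence of coefficients. *)
Definition fps := nat -> rat.

Definition fps_const (c : rat) : fps := fun n => if n is 0%N then c else 0.

Definition fps_add (a b : fps) : fps := fun n => a n + b n.

Definition fps_mul (a b : fps) : fps := fun n => \sum_(i < n.+1) a i * b (n - i)%N.

(* The series of e^(c x). *)
Definition fps_exp (c : rat) : fps := fun n => c ^+ n / n`!%:R.

(* [fps_inv_seq a n] lists the coefficients of degree 0, ..., n - 1 of the
   inverse of [a]; see [fps_mulV]. *)
Fixpoint fps_inv_seq (a : fps) (n : nat) : seq rat :=
  if n is m.+1 then
    let s := fps_inv_seq a m in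
    rcons s ((fps_const 1 m - \sum_(i < m) a (m - i)%N * s`_i) / a 0%N)
  else [::].

Definition fps_inv (a : fps) : fps := fun n => (fps_inv_seq a n.+1)`_n.

Definition fps_div (a b : fps) : fps := fps_mul a (fps_inv b).

Lemma size_fps_inv_seq a n : size (fps_inv_seq a n) = n.
Proof. by elim: n => //= n IHn; rewrite size_rcons IHn. Qed.

Lemma nth_fps_inv_seq a n i : (i < n)%N -> (fps_inv_seq a n)`_i = fps_inv a i.
Proof.
elim: n => // n IHn; rewrite ltnS leq_eqVlt => /predU1P[-> // | lt_i_n].
by rewrite /= nth_rcons size_fps_inv_seq lt_i_n IHn.
Qed.

Lemma fps_mulV (a : fps) : a 0%N != 0 -> fps_mul a (fps_inv a) =1 fps_const 1.
Proof.
move=> a0 n; rewrite /fps_mul big_ord_recl subn0.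
rewrite {1}/fps_inv /= nth_rcons size_fps_inv_seq ltnn eqxx mulrC divfK //.
rewrite [X in _ + X](reindex_inj rev_ord_inj) /=.
rewrite -[RHS](subrK (\sum_(i < n) a (n - i)%N * (fps_inv_seq a n)`_i)).
congr (_ + _); apply: eq_bigr => i _.
have lt_i_n := ltn_ord i.
have e : bump 0 (n - i.+1) = (n - i)%N by rewrite /bump add1n subnSK.
by rewrite e subKn ?(ltnW lt_i_n) // nth_fps_inv_seq.
Qed.

(* E_n = n! [x^n] 2 / (e^x + e^(-x)). *)
Definition euler_number (n : nat) : rat :=
  n`!%:R * fps_div (fps_const 2) (fps_add (fps_exp 1) (fps_exp (- 1))) n.

Lemma euler_gf :
  fps_mul (fps_add (fps_exp 1) (fps_exp (- 1)))
          (fun n => euler_number n / n`!%:R) =1 fps_const 2.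
Proof.
have E k : euler_number k / k`!%:R =
    2 * fps_inv (fps_add (fps_exp 1) (fps_exp (- 1))) k.
  rewrite /euler_number /fps_div mulrC mulKf ?pnatr_eq0 -?lt0n ?fact_gt0 //.
  by rewrite /fps_mul big_ord_recl subn0 big1 ?addr0 // => i _; rewrite mul0r.
move=> n; rewrite /fps_mul.
under eq_bigr do rewrite E mulrCA.
rewrite -mulr_sumr; have /= := fps_mulV (a := fps_add (fps_exp 1) (fps_exp (- 1))) _ n.
rewrite /fps_mul => -> //.
by case: n => [|n] /=; rewrite ?mulr1 ?mulr0.
Qed.

(* The ring Z_(p) of p-integral rationals, for p prime. *)
Definition p_integral (p : nat) : {pred rat} := [pred x | coprime p `|denq x|%N].

Definition p_congruent (p m : nat) (x y : rat) : Prop :=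
  [/\ x \in p_integral p, y \in p_integral p &
      exists2 z, z \in p_integral p & x - y = m%:R * z].

(* Main.v *)
Require Import Defs.
From mathcomp Require Import all_boot all_order all_algebra.
From HB Require Import structures.
From mathcomp Require Import ring lra zify.

Import Order.TTheory GRing.Theory Num.Theory.
Local Open Scope ring_scope.

Set Implicit Arguments.
Unset Strict Implicit.
Unset Printing Implicit Defensive.

(* The expansion Domb n = sum_k (-1)^k 16^(n-k) C(n+2k,3k) C(2k,k)^2 C(3k,k) makes the sum over n
   telescope, and with p = 2m+1 the left-hand side becomes p 4^-m U, where
     U = sum_(k<p) C(2k,k) C(p-1,k) C(p+k,k) C(p+2k,k) (-1/16)^k.
   Put a_k = C(2k,k)^2 / 16^k.  The terms of U with k > m are 2 a_k modulo p^3.  Those with k <= m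
   agree modulo p^2 with the terms of a Chu-Vandermonde sum whose value is (-1)^m 4^m modulo p^3 by
   Morley's congruence, and the p^2-corrections are harmonic sums of order 2.  The sum of all the
   a_k comes from S(x) + S(x-1) = 2 prod_(0<j<p) (1 - x^2/j^2), S(x) = sum_(k<p) C(x,k) C(-1-x,k),
   iterated from x = -1/2 down to x = -p/2.  Everything reduces to sum_(r<=m) (-1)^r / r^2, which is
   2 (-1)^m E_(p-3) modulo p by the alternating power sum formula for Euler polynomials. *)

(** * The Domb numbers *)

(** The factor p split off by the telescoping is exact, so U is needed modulo p^3 only. For k <= m a
    direct comparison of its terms with the a_k leaves a part of order p, a harmonic sum of order 1.
    The Chu-Vandermonde parameters 1/2 + p and 1 + p/2 are chosen to reproduce that part, and since
    1 + p/2 - (1/2 + p) = -m the value collapses to a single product, the one in Morley's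
    congruence. The a_k are the values of C(x,k) C(-1-x,k) at x = -1/2. At integers x the sums of
    such terms, also weighted by harmonic numbers, have exact values because the products of 1 -
    x^2/j^2 vanish there. The integer m = -1/2 + p/2 is p-adically close to -1/2, and the terms
    depend on (x + 1/2)^2 alone, so passing from -1/2 to m costs only order p^2. *)

Lemma fact_neq0 (n : nat) : n`!%:R != 0 :> rat.
Proof. by rewrite pnatr_eq0 -lt0n fact_gt0. Qed.

Ltac pose_natr_ge0 n :=
  lazymatch goal with
  | _ : is_true (0 <= n%:R) |- _ => fail
  | _ => have ? : 0 <= n%:R :> rat by exact: ler0n
  end.

Ltac nonzero :=
  repeat match goal with
  | n : nat |- _ => pose_natr_ge0 n
  | |- context [nat_of_ord ?k] => pose_natr_ge0 (nat_of_ord k)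
  | |- context [(?n - ?k)%N] => pose_natr_ge0 (n - k)%N
  end;
  repeat (apply/andP; split); rewrite ?fact_neq0 //; apply: lt0r_neq0; lra.

Lemma bin_fact_rat (n k : nat) : 'C(n + k, k)%:R = (n + k)`!%:R / (k`!%:R * n`!%:R) :> rat.
Proof.
apply: (mulIf (x := k`!%:R * n`!%:R)); first by rewrite mulf_neq0 ?fact_neq0.
rewrite divfK ?mulf_neq0 ?fact_neq0 // -!natrM; congr (_%:R).
by have := @bin_fact (n + k) k (leq_addl _ _); rewrite addnK.
Qed.

(** The summand of a Domb number is n!^2 times a function of k times the same function of n - k;
    this is that function. *)
Definition domb_weight (k : nat) : rat := 'C(2 * k, k)%:R / k`!%:R ^+ 2.

Lemma domb_weight_fact k : domb_weight k = (2 * k)`!%:R / k`!%:R ^+ 4.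
Proof.
rewrite /domb_weight mul2n -addnn bin_fact_rat; have := fact_neq0 k.
by move=> h; field.
Qed.

Lemma domb_weightS k : domb_weight k = k.+1%:R ^+ 3 / (2 * (2 * k.+1%:R - 1)) * domb_weight k.+1.
Proof.
rewrite !domb_weight_fact mulnS !factS !natrM -!natr1 !natrM.
field; nonzero.
Qed.

Lemma double_pred_neq0 (n : nat) : 2 * n%:R - 1 != 0 :> rat.
Proof. by case: n => [|n]; rewrite ?mulr0 ?sub0r ?oppr_eq0 ?oner_eq0 //; nonzero. Qed.

Definition domb_conv (n : nat) : rat := \sum_(k < n.+1) domb_weight k * domb_weight (n - k).

Lemma Domb_conv n : (Domb n)%:R = n`!%:R ^+ 2 * domb_conv n :> rat.
Proof.
rewrite /Domb /domb_conv natr_sum mulr_sumr; apply: eq_bigr => -[k /= lt_kn] _.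
have [l ->] : exists l, n = (l + k)%N by exists (n - k)%N; lia.
rewrite 2!natrM natrX bin_fact_rat addnK mulnDr addnK.
rewrite /domb_weight; field; nonzero.
Qed.

(* Zeilberger's certificate for the convolution of [domb_weight] with itself. *)
Definition domb_cert (x y : rat) : rat :=
  4 * y ^+ 3 + (6 - 18 * x) * y ^+ 2 + (26 * x ^+ 2 - 15 * x) * y - 12 * x ^+ 3 + 10 * x ^+ 2.

Lemma domb_conv_rec n (x := n.+2%:R : rat) :
  x ^+ 5 * domb_conv n.+2 - 2 * (2 * x - 1) * (5 * x ^+ 2 - 5 * x + 2) * domb_conv n.+1
  + 64 * (x - 1) * domb_conv n = 0.
Proof.
pose w (k : nat) := domb_weight k * domb_weight (n.+2 - k).
pose l (k : nat) : rat := x - k%:R.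
(* The factors [l k] and [l k - 1] vanish at the added top indices, so all three sums can run over
   one range with one weight [w]. *)
have c1 : domb_conv n.+1 = \sum_(k < n.+3) l k ^+ 3 / (2 * (2 * l k - 1)) * w k.
  rewrite big_ord_recr /= /l /x subrr expr0n !mul0r addr0.
  apply: eq_bigr => -[k /= lt_k] _; rewrite /w.
  by rewrite (domb_weightS (n.+1 - k)) -natrB ?(ltnW lt_k) // -subSn // mulrCA.
have c0 : domb_conv n = \sum_(k < n.+3) l k ^+ 3 * (l k - 1) ^+ 3 /
    (4 * (2 * l k - 1) * (2 * l k - 3)) * w k.
  rewrite 2!big_ord_recr /= /l /x subrr expr0n !mul0r addr0.
  rewrite -natrB // subSnn subrr expr0n mulr0 !mul0r addr0.
  apply: eq_bigr => -[k /= lt_k] _; rewrite /w -natrB; last by lia.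
  have -> : (n.+2 - k = (n - k).+2)%N by lia.
  rewrite (domb_weightS (n - k)) (domb_weightS (n - k).+1) -!natr1; field; nonzero.
rewrite c1 c0 /domb_conv !mulr_sumr -sumrB -big_split /=.
pose G (k : nat) := k%:R ^+ 3 * domb_cert x k%:R / (2 * l k - 1) * w k.
(* Subtraction on [nat] truncates, so [G n.+3] is not the zero that ends the telescoping; the
   conditional puts it in by hand. *)
rewrite (eq_bigr (fun k : 'I_n.+3 => (if (k < n.+2)%N then G k.+1 else 0) - G k)); last first.
  move=> -[k /= lt_k] _; rewrite -[domb_weight k * _]/(w k).
  case: ifP => [lt_k2|ge_k]; last first.
    have -> : k = n.+2 by lia.
    by rewrite /G /l subrr /domb_cert -/x; field.
  rewrite /G /domb_cert /l.
  have [i ni] : exists i, n.+2 = (i.+1 + k)%N by exists (n.+1 - k)%N; lia.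
  have ex : x = i%:R + 1 + k%:R by rewrite /x ni natrD -natr1.
  rewrite /w subSS; have -> : (n.+1 - k = i)%N by lia.
  rewrite ni addnK (domb_weightS i) [domb_weight k]domb_weightS ex -!natr1.
  field.
  rewrite addrK (_ : i%:R + 1 + k%:R - (k%:R + 1) = i%:R); last by ring.
  by rewrite double_pred_neq0 andbT; nonzero.
rewrite sumrB big_ord_recr /= ltnn addr0 [X in _ - X]big_ord_recl {2}/G /= expr0n !mul0r add0r.
by apply/eqP; rewrite subr_eq0; apply/eqP/eq_bigr => -[k /= lt_k] _; rewrite lt_k.
Qed.

(** * The alternating expansion of the Domb numbers *)

Definition domb_term (n k : nat) : rat :=
  (- 1) ^+ k * 16 ^+ n / 16 ^+ k * ('C(n + 2 * k, 3 * k) * ('C(2 * k, k) ^ 2 * 'C(3 * k, k)))%:R.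

Lemma domb_term_fact i k : domb_term (i + k) k =
  (- 1) ^+ k * 16 ^+ i * (i + 3 * k)`!%:R * (2 * k)`!%:R / (i`!%:R * k`!%:R ^+ 5).
Proof.
rewrite /domb_term (_ : i + k + 2 * k = i + 3 * k)%N; last by lia.
rewrite !natrM bin_fact_rat.
have -> : 'C(2 * k, k) = 'C(k + k, k) by congr 'C(_, _); lia.
have -> : 'C(3 * k, k) = 'C(2 * k + k, k) by congr 'C(_, _); lia.
rewrite !bin_fact_rat exprD addnn -mul2n (_ : 2 * k + k = 3 * k)%N; last by lia.
have h : 16 ^+ k != 0 :> rat by rewrite expf_neq0.
by field; rewrite h; nonzero.
Qed.

Lemma domb_term_small n k : (n < k)%N -> domb_term n k = 0.
Proof. by move=> lt_nk; rewrite /domb_term bin_small ?mul0n ?mulr0 //; lia. Qed.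

Lemma domb_term_nS n k :
  domb_term n k = (n.+1%:R - k%:R) / (16 * (n.+1%:R + 2 * k%:R)) * domb_term n.+1 k.
Proof.
have [le_kn|] := leqP k n; last first.
  move=> lt_nk; rewrite domb_term_small //.
  have [->|ne] := eqVneq k n.+1; first by rewrite subrr !mul0r.
  by rewrite domb_term_small ?mulr0 //; lia.
have [i ->] : exists i, n = (i + k)%N by exists (n - k)%N; lia.
rewrite -addSn !domb_term_fact (addSn i (3 * k)) !factS.
rewrite [16 ^+ i.+1]exprS; move: (16 ^+ i) ((- 1) ^+ k) => y z. field; nonzero.
Qed.

Lemma domb_term_kS n k : (k < n)%N ->
  domb_term n k.+1 = - (n%:R - k%:R) * (n%:R + 2 * k%:R + 1) * (n%:R + 2 * k%:R + 2)
    * (2 * k%:R + 1) / (8 * (k%:R + 1) ^+ 4) * domb_term n k.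
Proof.
move=> lt_kn; have [i ->] : exists i, n = (i + k.+1)%N by exists (n - k.+1)%N; lia.
rewrite domb_term_fact -addSnnS domb_term_fact.
rewrite (_ : i + 3 * k.+1 = (i.+1 + 3 * k).+2)%N; last by lia.
rewrite (_ : 2 * k.+1 = (2 * k).+2)%N; last by lia.
rewrite !factS [16 ^+ i.+1]exprS [(- 1) ^+ k.+1]exprS; move: (16 ^+ i) ((- 1) ^+ k) => y z.
field; nonzero.
Qed.

Definition domb_alt (n : nat) : rat := \sum_(k < n.+1) domb_term n k.

Lemma domb_alt_rec n (x := n.+2%:R : rat) :
  x ^+ 3 * domb_alt n.+2 - 2 * (2 * x - 1) * (5 * x ^+ 2 - 5 * x + 2) * domb_alt n.+1
  + 64 * (x - 1) ^+ 3 * domb_alt n = 0.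
Proof.
pose w (k : nat) := domb_term n.+2 k.
have x1 : n.+1%:R = x - 1 by rewrite /x -[n.+2%:R]natr1 addrK.
have E1 k : domb_term n.+1 k = (x - k%:R) / (16 * (x + 2 * k%:R)) * w k.
  by rewrite domb_term_nS.
have c1 : domb_alt n.+1 = \sum_(k < n.+3) (x - k%:R) / (16 * (x + 2 * k%:R)) * w k.
  rewrite big_ord_recr /= /x subrr !mul0r addr0.
  by apply: eq_bigr => k _; rewrite E1.
have c0 : domb_alt n = \sum_(k < n.+3) (x - k%:R) * (x - 1 - k%:R) /
    (256 * (x + 2 * k%:R) * (x - 1 + 2 * k%:R)) * w k.
  rewrite 2!big_ord_recr /= -/x -x1 (subrr x) (subrr n.+1%:R) mulr0 !mul0r !addr0.
  apply: eq_bigr => k _; rewrite domb_term_nS E1 /x.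
  field; nonzero.
rewrite c1 c0 /domb_alt !mulr_sumr -sumrB -big_split /=.
(* Certificate of creative telescoping: k^4 makes [G 0] vanish and clears the denominator (k+1)^4 of
   the term ratio in [domb_term_kS]. *)
pose G (k : nat) := k%:R ^+ 4 * (3 - 9 * x) / ((x + 2 * k%:R) * (x + 2 * k%:R - 1)) * w k.
rewrite (eq_bigr (fun k : 'I_n.+3 => (if (k < n.+2)%N then G k.+1 else 0) - G k)); last first.
  move=> -[k /= lt_k] _; rewrite -[domb_term _ k]/(w k).
  case: ifP => [lt_k2|ge_k]; last first.
    have -> : k = n.+2 by lia.
    rewrite /G -/x /x; field; nonzero.
  rewrite /G /w domb_term_kS // /x; field; nonzero.
rewrite sumrB big_ord_recr /= ltnn addr0 [X in _ - X]big_ord_recl {2}/G /= expr0n !mul0r add0r.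
by apply/eqP; rewrite subr_eq0; apply/eqP/eq_bigr => -[k /= lt_k] _; rewrite lt_k.
Qed.

Lemma Domb_rec n (x := n.+2%:R : rat) :
  x ^+ 3 * (Domb n.+2)%:R - 2 * (2 * x - 1) * (5 * x ^+ 2 - 5 * x + 2) * (Domb n.+1)%:R
  + 64 * (x - 1) ^+ 3 * (Domb n)%:R = 0.
Proof.
rewrite !Domb_conv !factS !natrM; have := domb_conv_rec n; rewrite -/x => rec.
have x1 : n.+1%:R = x - 1 by rewrite /x -[n.+2%:R]natr1 addrK.
rewrite -/x x1 -[RHS](mulr0 ((x - 1) ^+ 2 * n`!%:R ^+ 2)) -rec.
ring.
Qed.

(** Both sides satisfy the same recurrence of order two, with leading coefficient (n+2)^3 never
    zero, so the induction carries two consecutive values. *)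
Lemma Domb_alt n : (Domb n)%:R = \sum_(k < n.+1) domb_term n k.
Proof.
rewrite -/(domb_alt n).
suff [] : (Domb n)%:R = domb_alt n /\ (Domb n.+1)%:R = domb_alt n.+1 by [].
elim: n => [|n [IH0 IH1]].
  by split; rewrite /Domb /domb_alt !big_ord_recr !big_ord0 /= /domb_term.
split=> //; have x0 : n.+2%:R ^+ 3 != 0 :> rat by rewrite expf_neq0 ?pnatr_eq0.
apply: (mulfI x0); have := domb_alt_rec n; rewrite -{1}(Domb_rec n) /= IH0 IH1 => e.
lra.
Qed.

(** For fixed k the summand has a hypergeometric antidifference in n, namely the right-hand side;
    this is what makes the alternating expansion useful. *)
Lemma domb_term_partial_sum N k :
  \sum_(n < N) (3 * n + 1)%:R / (- 32) ^+ n * domb_term n k =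
  - 2 * (N%:R - k%:R) * domb_term N k / (- 32) ^+ N.
Proof.
elim: N => [|N IH].
  rewrite big_ord0; case: k => [|k]; first by rewrite subrr mulr0 !mul0r.
  by rewrite domb_term_small // mulr0 mul0r.
rewrite big_ord_recr /= IH (domb_term_nS N) exprS.
have h : (- 32) ^+ N != 0 :> rat by rewrite expf_neq0.
by field; rewrite h; nonzero.
Qed.

(* [trunc_term p k] is (-1/16)^k C(2k,k) C(p-1,k) C(p+k,k) C(p+2k,k), written
   as the product of its term ratios. *)
Definition trunc_term (x : rat) (k : nat) : rat :=
  \prod_(j < k) ((2 * j%:R + 1) * (j%:R + 1 - x) * (x + 2 * j%:R + 1) * (x + 2 * j%:R + 2)
    / (8 * (j%:R + 1) ^+ 4)).

(** The factor N - k from the antidifference combines with the binomials so that an exact N comes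
    out; it becomes the p in front of the truncated sum. *)
Lemma domb_term_trunc N k : (k < N)%N ->
  (N%:R - k%:R) * domb_term N k = N%:R * 16 ^+ N * trunc_term N%:R k.
Proof.
elim: k => [|k IH] lt_kN.
  rewrite /trunc_term big_ord0 /domb_term !expr0 !muln0 !bin0 divr1 subr0 mul1r !mulr1.
  by [].
rewrite /trunc_term big_ord_recr /= -/(trunc_term N%:R k) [RHS]mulrA -IH; last by lia.
rewrite domb_term_kS; last by lia.
field; nonzero.
Qed.

Lemma Domb_sum N : (0 < N)%N ->
  \sum_(n < N) (3 * n + 1)%:R / (- 32) ^+ n * (Domb n)%:R =
  N%:R * (- 2) / (- 2) ^+ N * \sum_(k < N) trunc_term N%:R k.
Proof.
move=> N_gt0.
transitivity (\sum_(n < N) \sum_(k < N) (3 * n + 1)%:R / (- 32) ^+ n * domb_term n k).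
  apply: eq_bigr => -[n /= lt_nN] _; rewrite Domb_alt -mulr_sumr; congr (_ * _).
  rewrite (big_ord_widen N (domb_term n)) // big_mkcond; apply: eq_bigr => k _.
  by rewrite ltnS; case: leqP => // lt_nk; rewrite domb_term_small.
rewrite exchange_big mulr_sumr; apply: eq_bigr => -[k /= lt_kN] _.
rewrite domb_term_partial_sum -(mulrA (- 2)) domb_term_trunc //.
have -> : (- 32) ^+ N = 16 ^+ N * (- 2) ^+ N :> rat by rewrite -exprMn; congr (_ ^+ _).
have h1 : 16 ^+ N != 0 :> rat by rewrite expf_neq0.
have h2 : (- 2) ^+ N != 0 :> rat by rewrite expf_neq0.
move: (16 ^+ N) ((- 2) ^+ N) h1 h2 => y z h1 h2.
by field; rewrite h1 h2.
Qed.

(** * Congruences between p-integral rationals *)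

Lemma p_integralP p (x : rat) :
  reflect (exists2 d : nat, coprime p d & exists z : int, x * d%:R = z%:~R) (x \in p_integral p).
Proof.
apply: (iffP idP) => [px|[d cpd [z e]]].
  exists `|denq x|%N => //; exists (numq x).
  by rewrite numqE natr_absz ger0_norm ?denq_ge0.
(* A zero d is coprime to p only for p = 1, where every rational is integral. *)
have [d0|d_neq0] := eqVneq d 0%N.
  move: cpd; rewrite d0 /coprime gcdn0 => /eqP ->.
  by rewrite inE coprime1n.
rewrite inE; apply: coprime_dvdr cpd.
have : (denq x %| d%:Z)%Z.
  rewrite -(Gauss_dvdzr _ (n := numq x)); last by rewrite coprimezE coprime_sym coprime_num_den.
  apply/dvdzP; exists z; apply/eqP; rewrite -(eqr_int rat) !intrM -e numqE -pmulrn.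
  by apply/eqP; ring.
by rewrite dvdzE absz_nat.
Qed.

Fact p_integral_subring p : subring_closed (p_integral p).
Proof.
split=> [|x y /p_integralP[d pd [z ez]] /p_integralP[d' pd' [z' ez']]|
          x y /p_integralP[d pd [z ez]] /p_integralP[d' pd' [z' ez']]].
- by apply/p_integralP; exists 1%N; [exact: coprimen1 | exists 1].
- apply/p_integralP; exists (d * d')%N; first by rewrite coprimeMr pd pd'.
  exists (z * d'%:Z - z' * d%:Z); rewrite intrB !intrM -ez -ez' -!pmulrn natrM; ring.
- apply/p_integralP; exists (d * d')%N; first by rewrite coprimeMr pd pd'.
  by exists (z * z'); rewrite intrM -ez -ez' natrM; ring.
Qed.
HB.instance Definition _ p := GRing.isSubringClosed.Build rat (p_integral p) (p_integral_subring p).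

Lemma p_integralD p x y : x \in p_integral p -> y \in p_integral p -> x + y \in p_integral p.
Proof. exact: rpredD. Qed.

Lemma p_integralN p x : x \in p_integral p -> - x \in p_integral p.
Proof. by rewrite rpredN. Qed.

Lemma p_integralM p x y : x \in p_integral p -> y \in p_integral p -> x * y \in p_integral p.
Proof. exact: rpredM. Qed.

Lemma p_integralX p x n : x \in p_integral p -> x ^+ n \in p_integral p.
Proof. exact: rpredX. Qed.

Lemma p_integral_nat p n : n%:R \in p_integral p.
Proof. exact: rpred_nat. Qed.

Lemma p_integral1 p : 1 \in p_integral p.
Proof. exact: rpred1. Qed.

Ltac integral := try assumption; lazymatch goal with
  | |- is_true (?x \in _) => lazymatch x with
    | 1%R => exact: p_integral1
    | (_%:R)%R => exact: p_integral_nat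
    | GRing.opp _ => apply: p_integralN; integral
    | GRing.add _ _ => apply: p_integralD; integral
    | GRing.mul _ _ => apply: p_integralM; integral
    | GRing.exp _ _ => apply: p_integralX; integral
    | _ => idtac
    end
  end.

(** * Divisibility by powers of p and congruences *)

Definition pdvd (p n : nat) : {pred rat} := [pred x | x / p%:R ^+ n \in p_integral p].

Lemma pdvdE p n x : (x \in pdvd p n) = (x / p%:R ^+ n \in p_integral p).
Proof. by []. Qed.

Fact pdvd_zmod p n : zmod_closed (pdvd p n).
Proof.
split=> [|x y]; rewrite !pdvdE ?mul0r; first exact: rpred0.
by move=> px py; rewrite mulrBl; apply: rpredB.
Qed.
HB.instance Definition _ p n := GRing.isZmodClosed.Build rat (pdvd p n) (pdvd_zmod p n).

Section Congruences.
Variable p : nat.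
Hypothesis p_gt0 : (0 < p)%N.
Local Notation Z := (p_integral p).
Implicit Types (x y z : rat) (n : nat).

Lemma p_neq0 : p%:R != 0 :> rat.
Proof. by rewrite pnatr_eq0 -lt0n. Qed.

Lemma pdvd0 x : (x \in pdvd p 0) = (x \in Z).
Proof. by rewrite pdvdE expr0 divr1. Qed.

Lemma pdvdM n m x y : x \in pdvd p n -> y \in pdvd p m -> x * y \in pdvd p (n + m).
Proof.
rewrite !pdvdE => px py; rewrite exprD invfM mulrACA.
exact: rpredM.
Qed.

Lemma pdvd_mull n x y : x \in Z -> y \in pdvd p n -> x * y \in pdvd p n.
Proof. by rewrite -pdvd0 => px /(pdvdM px). Qed.

Lemma pdvd_mulr n x y : x \in pdvd p n -> y \in Z -> x * y \in pdvd p n.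
Proof. by rewrite mulrC => px py; apply: pdvd_mull. Qed.

Lemma pdvdW m n x : (m <= n)%N -> x \in pdvd p n -> x \in pdvd p m.
Proof.
move=> le_mn; rewrite !pdvdE => px.
have -> : x / p%:R ^+ m = x / p%:R ^+ n * p%:R ^+ (n - m).
  rewrite -{1}(subnKC le_mn) exprD invfM mulrA divfK //.
  by rewrite expf_neq0 // p_neq0.
apply: rpredM => //; rewrite rpredX //; exact: rpred_nat.
Qed.

Lemma pdvdZ n x : x \in pdvd p n -> x \in Z.
Proof. by rewrite -pdvd0; apply: pdvdW. Qed.

Lemma pdvdX n : p%:R ^+ n \in pdvd p n.
Proof. by rewrite pdvdE divff ?expf_neq0 ?p_neq0 // rpred1. Qed.

Lemma pdvdP n x : reflect (exists2 z, z \in Z & x = p%:R ^+ n * z) (x \in pdvd p n).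
Proof.
apply: (iffP idP) => [px|[z pz ->]]; last by apply: pdvd_mulr (pdvdX n) pz.
by exists (x / p%:R ^+ n) => //; rewrite mulrC divfK // expf_neq0 ?p_neq0.
Qed.

Definition pcong n x y := x - y \in pdvd p n.

Lemma pcongE n x y : pcong n x y = (x - y \in pdvd p n).
Proof. by []. Qed.

Lemma pcong_refl n x : pcong n x x.
Proof. by rewrite /pcong subrr rpred0. Qed.

Lemma pcong_sym n x y : pcong n x y -> pcong n y x.
Proof. by rewrite /pcong -opprB rpredN. Qed.

Lemma pcong_trans n x y z : pcong n x y -> pcong n y z -> pcong n x z.
Proof. by rewrite /pcong => xy yz; rewrite -(subrKA y) rpredD. Qed.

Lemma pcongW m n x y : (m <= n)%N -> pcong n x y -> pcong m x y.
Proof. exact: pdvdW. Qed.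

Lemma pcong_integral n x y : pcong n x y -> y \in Z -> x \in Z.
Proof. by move=> /pdvdZ xy py; rewrite -(subrK y x) rpredD. Qed.

Lemma pcongD n x y x' y' : pcong n x x' -> pcong n y y' -> pcong n (x + y) (x' + y').
Proof. by rewrite /pcong => xx yy; rewrite opprD addrACA rpredD. Qed.

Lemma pcongN n x x' : pcong n x x' -> pcong n (- x) (- x').
Proof. by rewrite /pcong => xx; rewrite -opprD rpredN. Qed.

Lemma pcongM n x y x' y' : x \in Z -> y' \in Z ->
  pcong n x x' -> pcong n y y' -> pcong n (x * y) (x' * y').
Proof.
rewrite /pcong => px py' xx yy.
have -> : x * y - x' * y' = x * (y - y') + (x - x') * y' by ring.
by apply: rpredD; [exact: pdvd_mull | exact: pdvd_mulr].
Qed.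

Lemma pcongMl n z x y : z \in Z -> pcong n x y -> pcong n (z * x) (z * y).
Proof. by rewrite /pcong -mulrBr; apply: pdvd_mull. Qed.

Lemma pcongMX n m x y : pcong m x y -> pcong (n + m) (p%:R ^+ n * x) (p%:R ^+ n * y).
Proof. by rewrite /pcong -mulrBr => /(pdvdM (pdvdX n)). Qed.

Lemma pcong_sum n (I : finType) (P : pred I) (F G : I -> rat) :
  (forall i, P i -> pcong n (F i) (G i)) ->
  pcong n (\sum_(i | P i) F i) (\sum_(i | P i) G i).
Proof. by move=> FG; rewrite /pcong -sumrB; apply: rpred_sum. Qed.

Lemma pcong_prod n k (F G : nat -> rat) :
  (forall i, (i < k)%N -> G i \in Z) ->
  (forall i, (i < k)%N -> pcong n (F i) (G i)) ->
  pcong n (\prod_(i < k) F i) (\prod_(i < k) G i).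
Proof.
elim: k => [|k IH] Gz FG; first by rewrite !big_ord0 pcong_refl.
rewrite !big_ord_recr /=; apply: pcongM; last exact: FG.
- rewrite rpred_prod // => i _.
  by apply: (pcong_integral (FG i _) (Gz i _)); rewrite ltnS ltnW.
- exact: Gz.
- by apply: IH => i lt_ik; [apply: Gz | apply: FG]; rewrite ltnS ltnW.
Qed.

Lemma pcong_of n z x y : z \in Z -> x = y + p%:R ^+ n * z -> pcong n x y.
Proof.
move=> pz ->; rewrite /pcong [y + _]addrC addrK; apply/pdvdP.
by exists z.
Qed.

Lemma pcong_prod_sqr k (F c : nat -> rat) :
  (forall i, (i < k)%N -> c i \in Z) ->
  (forall i, (i < k)%N -> pcong 3 (F i) (1 + p%:R ^+ 2 * c i)) ->
  pcong 3 (\prod_(i < k) F i) (1 + p%:R ^+ 2 * \sum_(i < k) c i).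
Proof.
move=> cZ FE.
apply: (@pcong_trans _ _ (\prod_(i < k) (1 + p%:R ^+ 2 * c i))).
  apply: (pcong_prod (G := fun i => 1 + p%:R ^+ 2 * c i)) => // i lt_ik.
  by rewrite rpredD ?rpred1 // rpredM ?cZ // rpredX ?rpred_nat.
elim: k cZ {FE} => [|k IH] cZ; first by rewrite !big_ord0 mulr0 addr0 pcong_refl.
have cZ' i : (i < k)%N -> c i \in Z by move=> lt_ik; apply: cZ; rewrite ltnS ltnW.
have pZ : p%:R \in Z by rewrite rpred_nat.
have sZ : \sum_(i < k) c i \in Z by rewrite rpred_sum // => i _; rewrite cZ'.
rewrite !big_ord_recr /=.
apply: (@pcong_trans _ _ ((1 + p%:R ^+ 2 * \sum_(i < k) c i) * (1 + p%:R ^+ 2 * c k))).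
  rewrite mulrC [X in pcong 3 _ X]mulrC; apply: pcongMl; last exact: IH.
  by rewrite rpredD ?rpred1 // rpredM ?cZ // rpredX.
apply: (@pcong_of _ (p%:R * (\sum_(i < k) c i) * c k)); last by ring.
by rewrite !rpredM ?cZ.
Qed.

(** The coefficient of p^2 is the second elementary symmetric function of the c i, written through
    power sums; hence the division by 2. *)
Lemma pcong_prod_lin k (c : nat -> rat) : 2^-1 \in Z ->
  (forall i, (i < k)%N -> c i \in Z) ->
  pcong 3 (\prod_(i < k) (1 + p%:R * c i))
    (1 + p%:R * \sum_(i < k) c i +
     p%:R ^+ 2 * ((\sum_(i < k) c i) ^+ 2 - \sum_(i < k) c i ^+ 2) / 2).
Proof.
move=> Z2; elim: k => [|k IH] cZ.
  by rewrite !big_ord0 expr0n subrr !mulr0 !mul0r !addr0 pcong_refl.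
have cZ' i : (i < k)%N -> c i \in Z by move=> lt_ik; apply: cZ; rewrite ltnS ltnW.
have pZ : p%:R \in Z by rewrite rpred_nat.
have sZ : \sum_(i < k) c i \in Z by rewrite rpred_sum // => i _; rewrite cZ'.
have tZ : \sum_(i < k) c i ^+ 2 \in Z by rewrite rpred_sum // => i _; rewrite rpredX ?cZ'.
rewrite !big_ord_recr /=.
apply: (pcong_trans (y := (1 + p%:R * \sum_(i < k) c i +
   p%:R ^+ 2 * ((\sum_(i < k) c i) ^+ 2 - \sum_(i < k) c i ^+ 2) / 2) * (1 + p%:R * c k))).
  rewrite mulrC [X in pcong 3 _ X]mulrC; apply: pcongMl; last exact: IH.
  by rewrite rpredD ?rpred1 // rpredM ?cZ.
apply: (@pcong_of _ (((\sum_(i < k) c i) ^+ 2 - \sum_(i < k) c i ^+ 2) / 2 * c k)); last by field.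
by rewrite !rpredM ?cZ // rpredB // rpredX.
Qed.

End Congruences.

Section PrimeCongruences.
Variable p : nat.
Hypothesis p_prime : prime p.
Local Notation Z := (p_integral p).
Local Notation pcong := (pcong p).
Implicit Types (x y z : rat) (n : nat).

Let p_gt0 : (0 < p)%N := prime_gt0 p_prime.

Lemma invn_integral d : (0 < d)%N -> ~~ (p %| d)%N -> d%:R^-1 \in Z.
Proof.
move=> d_gt0 pd; apply/p_integralP; exists d; first by rewrite prime_coprime.
by exists 1; rewrite mulVf // pnatr_eq0 -lt0n.
Qed.

Lemma invp_nintegral : p%:R^-1 \notin Z.
Proof.
apply/p_integralP=> -[d pd [z e]].
have : (p%:Z %| d%:Z)%Z.
  apply/dvdzP; exists z; apply/eqP; rewrite -(eqr_int rat) intrM -e -!pmulrn.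
  by rewrite mulrC mulrA divff ?mul1r // p_neq0.
rewrite dvdzE !absz_nat => p_dvd; move: pd; rewrite prime_coprime // p_dvd //.
Qed.

(** * Units of the ring of p-integral rationals *)

Definition punit x := [&& x \in Z, x^-1 \in Z & x != 0].

Lemma punit_npdvd x : punit x -> x \notin pdvd p 1.
Proof.
case/and3P=> xZ xVZ x0; apply/negP => /pdvd_mulr-/(_ _ xVZ).
by rewrite divff // pdvdE expr1 mul1r; apply/negP/invp_nintegral.
Qed.

Lemma npdvd_punit x : x \in Z -> x \notin pdvd p 1 -> punit x.
Proof.
move=> xZ px; have x0 : x != 0 by apply: contraNneq px => ->; rewrite rpred0.
rewrite /punit xZ x0 andbT /=; apply/p_integralP.
have n0 : (numq x)%:~R != 0 :> rat by rewrite intr_eq0 numq_eq0.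
have d0 : (denq x)%:~R != 0 :> rat by rewrite intr_eq0 denq_eq0.
have xE := divq_num_den x.
exists `|numq x|%N; last first.
  exists (Num.sg (numq x) * denq x); rewrite intrM natr_absz normrEsg intrM -{1}xE.
  by field; rewrite n0 d0.
rewrite prime_coprime //; apply: contra px; rewrite -[(p %| _)%N]/(p%:Z %| numq x)%Z.
case/dvdzP=> z ez; rewrite pdvdE expr1; apply/p_integralP.
exists `|denq x|%N => //; exists z.
rewrite natr_absz ger0_norm ?denq_ge0 // -{1}xE ez intrM -pmulrn.
by field; rewrite d0 p_neq0.
Qed.

Lemma pcong_punit x y : pcong 1 x y -> punit y -> punit x.
Proof.
move=> xy uy; apply: npdvd_punit; first by case/and3P: uy => yZ _ _; apply: pcong_integral xy yZ.
apply: contra (punit_npdvd uy) => px.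
by rewrite -(subKr x y) rpredB.
Qed.

Lemma punit1 : punit 1.
Proof. by rewrite /punit invr1 rpred1 oner_eq0. Qed.

Lemma punitM x y : punit x -> punit y -> punit (x * y).
Proof.
case/and3P=> xZ xV x0 /and3P[yZ yV y0]; rewrite /punit invfM mulf_neq0 //.
by rewrite !rpredM.
Qed.

Lemma punitX x n : punit x -> punit (x ^+ n).
Proof. by move=> ux; elim: n => [|n IH]; rewrite ?punit1 // exprS punitM. Qed.

Lemma punitV x : punit x -> punit x^-1.
Proof. by case/and3P=> xZ xV x0; rewrite /punit invrK invr_eq0 xZ xV x0. Qed.

Lemma punitN x : punit (- x) = punit x.
Proof. by rewrite /punit invrN !rpredN oppr_eq0. Qed.

Lemma punit_nat d : (0 < d)%N -> ~~ (p %| d)%N -> punit d%:R.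
Proof. by move=> d0 pd; rewrite /punit rpred_nat invn_integral // pnatr_eq0 -lt0n. Qed.

Lemma pcongV n x y : punit x -> punit y -> pcong n x y -> pcong n x^-1 y^-1.
Proof.
case/and3P=> xZ xV x0 /and3P[yZ yV y0] xy; rewrite /pcong.
have -> : x^-1 - y^-1 = - (x^-1 * y^-1) * (x - y) by field; rewrite x0 y0.
by apply: pdvd_mull => //; rewrite rpredN rpredM.
Qed.

Lemma pcongI n z x y : punit z -> pcong n (z * x) (z * y) -> pcong n x y.
Proof.
case/and3P=> zZ zV z0 /(pcongMl zV).
by rewrite !mulrA mulVf // !mul1r.
Qed.

End PrimeCongruences.

(** * Sums of C(x,k) C(-1-x,k) *)

Definition harm2 (n : nat) : rat := \sum_(j < n) (j%:R + 1) ^- 2.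

(** * The Chu-Vandermonde identity *)

Lemma alt_pascal n (F : nat -> rat) :
  \sum_(k < n.+2) (- 1) ^+ k * 'C(n.+1, k)%:R * F k =
  \sum_(k < n.+1) (- 1) ^+ k * 'C(n, k)%:R * (F k - F k.+1).
Proof.
rewrite (eq_bigr (fun k : 'I_n.+1 => (- 1) ^+ k * 'C(n, k)%:R * F k
     + (- 1) ^+ k.+1 * 'C(n, k)%:R * F k.+1)); last by move=> k _; rewrite exprS; ring.
rewrite big_split /= big_ord_recl [X in _ = X + _]big_ord_recl /= !bin0 -addrA; congr (_ + _).
under eq_bigr do rewrite /= /bump /= add1n binS natrD mulrDr mulrDl.
rewrite big_split /=; congr (_ + _).
by rewrite big_ord_recr /= bin_small // mulr0 mul0r addr0.
Qed.

(** By [alt_pascal] the sum for n + 1 is a sum of differences of consecutive products. Each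
    difference is the former product times (c - b) / (c + k); pulling out (c - b) / c leaves the sum
    for n with c + 1 in place of c. *)
Lemma chu_vandermonde n (b c : rat) : (forall j, (j < n)%N -> c + j%:R != 0) ->
  \sum_(k < n.+1) (- 1) ^+ k * 'C(n, k)%:R * \prod_(j < k) ((b + j%:R) / (c + j%:R)) =
  \prod_(j < n) ((c - b + j%:R) / (c + j%:R)).
Proof.
elim: n c => [|n IH] c nz; first by rewrite big_ord_recl !big_ord0 /= bin0 !mulr1 addr0.
rewrite (alt_pascal n (fun k => \prod_(j < k) ((b + j%:R) / (c + j%:R)))).
have c0 : c != 0 by have := nz 0%N isT; rewrite addr0.
have nz' j : (j < n)%N -> c + 1 + j%:R != 0.
  by move=> ltj; rewrite -addrA nat1r; apply: nz.
rewrite big_ord_recl /= addr0 [RHS](_ : _ = (c - b) / c *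
   \prod_(j < n) ((c + 1 - b + j%:R) / (c + 1 + j%:R))); last first.
  congr (_ / _ * _); first by ring.
  by apply: eq_bigr => j _; rewrite /= /bump /= natrD; congr (_ / _); ring.
rewrite -IH // mulr_sumr; apply: eq_bigr => -[k /= ltk] _.
rewrite [RHS]mulrCA; congr (_ * _).
have key i : (i <= n)%N -> c / (c + i%:R) * \prod_(j < i) ((b + j%:R) / (c + j%:R)) =
    \prod_(j < i) ((b + j%:R) / (c + 1 + j%:R)).
  elim: i => [|i IHi] lti; first by rewrite !big_ord0 addr0 divff // mulr1.
  rewrite !big_ord_recr /= -IHi ?(ltnW lti) //.
  have h1 := nz i (ltnW lti); have h2 := nz' i lti; rewrite -natr1.
  rewrite (_ : c + (i%:R + 1) = c + 1 + i%:R); last by ring.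
  by field; rewrite h1 h2.
rewrite -key // big_ord_recr /=.
have h := nz k ltk; field; rewrite c0 h //.
Qed.

(* C(x,k) C(-1-x,k), the coefficient of a Legendre function. *)
Definition leg_term (x : rat) (k : nat) : rat :=
  \prod_(j < k) ((j%:R - x) * (j%:R + 1 + x) / (j%:R + 1) ^+ 2).

(* Partial product of sin(pi x) / (pi x). *)
Definition sin_prod (n : nat) (x : rat) : rat := \prod_(j < n) (1 - x ^+ 2 / (j%:R + 1) ^+ 2).

Lemma sin_prodS n x : sin_prod n.+1 x = sin_prod n x * (1 - x ^+ 2 / (n%:R + 1) ^+ 2).
Proof. by rewrite /sin_prod big_ord_recr. Qed.

(** Shifting the factors j + 1 + x by one index pairs them with the j - x into j^2 - x^2; only the
    end factors -x and k + 1 + x remain. *)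
Lemma leg_termS x k :
  leg_term x k.+1 = - x * (k%:R + 1 + x) / (k%:R + 1) ^+ 2 * sin_prod k x.
Proof.
elim: k => [|k IH].
  by rewrite /leg_term /sin_prod big_ord0 big_ord_recl big_ord0 /=; field.
rewrite /leg_term big_ord_recr /= -/(leg_term x k.+1) IH sin_prodS.
field; nonzero.
Qed.

Lemma leg_term_predS x k :
  leg_term (x - 1) k.+1 = x * (k%:R + 1 - x) / (k%:R + 1) ^+ 2 * sin_prod k x.
Proof.
rewrite [sin_prod k x](_ : _ = sin_prod k (- x)); last first.
  by apply: eq_bigr => j _; rewrite sqrrN.
transitivity (leg_term (- x) k.+1); last by rewrite leg_termS opprK.
by apply: eq_bigr => j _; congr (_ / _); ring.
Qed.

(** The end factors -x (k + 1 + x) and x (k + 1 - x) add up to -2 x^2, which is the numerator in the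
    step from one partial product to the next. *)
Lemma leg_term_pair x k :
  leg_term x k.+1 + leg_term (x - 1) k.+1 = 2 * (sin_prod k.+1 x - sin_prod k x).
Proof.
rewrite leg_termS leg_term_predS sin_prodS.
field; nonzero.
Qed.

Definition leg_sum (n : nat) (x : rat) : rat := \sum_(k < n) leg_term x k.

Lemma leg_sum_pair n x : leg_sum n.+1 x + leg_sum n.+1 (x - 1) = 2 * sin_prod n x.
Proof.
rewrite /leg_sum -big_split /=; elim: n => [|n IH].
  by rewrite big_ord_recl big_ord0 /leg_term /sin_prod !big_ord0; ring.
by rewrite big_ord_recr /= IH leg_term_pair; ring.
Qed.

(** Summation by parts: the paired terms are differences of [sin_prod], and the remaining sum of
    [sin_prod k x] / (k+1)^2 telescopes again after multiplication by x^2. *)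
Lemma leg_harm_pair n x : x != 0 ->
  \sum_(k < n.+1) harm2 k * (leg_term x k + leg_term (x - 1) k) =
  2 * harm2 n * sin_prod n x - 2 * (1 - sin_prod n x) / x ^+ 2.
Proof.
move=> x0; elim: n => [|n IH].
  by rewrite big_ord_recl big_ord0 /harm2 /sin_prod !big_ord0 /=; field.
rewrite big_ord_recr /= IH leg_term_pair sin_prodS /harm2 big_ord_recr /=.
rewrite -/(harm2 n); field; rewrite x0; nonzero.
Qed.

Lemma sin_prod_nat0 n i : (0 < i)%N -> (i <= n)%N -> sin_prod n i%:R = 0.
Proof.
case: i => // i _ lt_in; rewrite /sin_prod (bigD1 (Ordinal lt_in)) //= natr1.
by rewrite divff ?subrr ?mul0r // expf_neq0 // pnatr_eq0.
Qed.

Lemma leg_term0 k : leg_term 0 k.+1 = 0.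
Proof. by rewrite leg_termS oppr0 !mul0r. Qed.

Lemma leg_sum_nat n i : (i <= n)%N -> leg_sum n.+1 i%:R = (- 1) ^+ i.
Proof.
elim: i => [|i IH] le_in.
  rewrite /leg_sum big_ord_recl big1 => [|k _]; last exact: leg_term0.
  by rewrite addr0 /leg_term big_ord0.
have := leg_sum_pair n i.+1%:R; rewrite sin_prod_nat0 // mulr0 -{2}natr1 addrK.
by rewrite IH ?(ltnW le_in) // exprS => e; lra.
Qed.

Definition alt_harm2 (n : nat) : rat := \sum_(j < n) (- 1) ^+ j.+1 * (j%:R + 1) ^- 2.

Lemma leg_harm_nat n i : (i <= n)%N ->
  \sum_(k < n.+1) harm2 k * leg_term i%:R k = - 2 * (- 1) ^+ i * alt_harm2 i.
Proof.
elim: i => [|i IH] le_in.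
  rewrite /alt_harm2 big_ord0 mulr0 big_ord_recl /harm2 big_ord0 mul0r add0r.
  by rewrite big1 // => k _; rewrite leg_term0 mulr0.
have i0 : i.+1%:R != 0 :> rat by rewrite pnatr_eq0.
have := leg_harm_pair n i0.
rewrite sin_prod_nat0 // mulr0 -{2}natr1 addrK.
under eq_bigr do rewrite mulrDr.
rewrite big_split /= IH ?(ltnW le_in) // => e.
have {}e : \sum_(k < n.+1) harm2 k * leg_term i.+1%:R k =
  - 2 / i.+1%:R ^+ 2 + 2 * (- 1) ^+ i * alt_harm2 i.
  by apply: (addIr (- 2 * (- 1) ^+ i * alt_harm2 i)); rewrite e; ring.
rewrite e /alt_harm2 big_ord_recr /= -/(alt_harm2 i) [(- 1) ^+ i.+1]exprS.
 have : (- 1) ^+ i * (- 1) ^+ i = 1 :> rat by rewrite -expr2 sqrr_sign.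
move: ((- 1) ^+ i) => s ss.
transitivity (- 2 * (s * s) / i.+1%:R ^+ 2 + 2 * s * alt_harm2 i); first by rewrite ss mulr1.
field; nonzero.
Qed.

(** The same [leg_term u n.+1] is read once through [leg_termS] at u and once through
    [leg_term_predS] at u + 1. *)
Lemma sin_prod_shift n (u : rat) :
  (u + 1) * (n%:R - u) * sin_prod n (u + 1) = - u * (n%:R + 1 + u) * sin_prod n u.
Proof.
have := leg_term_predS (u + 1) n; rewrite addrK leg_termS => e.
have h : (n%:R + 1) ^+ 2 != 0 :> rat by rewrite natr1 expf_neq0 ?pnatr_eq0.
apply: (mulIf (invr_neq0 h)).
transitivity ((u + 1) * (n%:R + 1 - (u + 1)) / (n%:R + 1) ^+ 2 * sin_prod n (u + 1)); first by ring.
by rewrite -e; ring.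
Qed.

Lemma leg_sum_shift n (y : rat) r :
  leg_sum n.+1 (y + r%:R) = (- 1) ^+ r * leg_sum n.+1 y
    + 2 * \sum_(i < r) (- 1) ^+ (r - i.+1) * sin_prod n (y + i.+1%:R).
Proof.
elim: r => [|r IH]; first by rewrite big_ord0 addr0 mul1r mulr0 addr0.
have := leg_sum_pair n (y + r.+1%:R); rewrite -{2}natr1 addrA addrK IH => e.
rewrite big_ord_recr /= subnn expr0 mul1r exprS.
rewrite (eq_bigr (fun i : 'I_r => - ((- 1) ^+ (r - i.+1) * sin_prod n (y + i.+1%:R)))); last first.
  by move=> i _; rewrite subSS -[(r - i)%N]subnSK // exprS; ring.
by rewrite sumrN; lra.
Qed.

(** * The truncated sum modulo p^3 *)

Lemma sum_double n (F : nat -> rat) :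
  \sum_(j < 2 * n) F j = \sum_(j < n) (F (2 * j)%N + F (2 * j).+1).
Proof.
elim: n => [|n IH]; first by rewrite !big_ord0.
rewrite (_ : 2 * n.+1 = (2 * n).+2)%N; last by lia.
by rewrite !big_ord_recr /= IH -addrA.
Qed.

Lemma sum_fold n (F : nat -> rat) :
  \sum_(j < 2 * n) F j = \sum_(j < n) (F j + F (2 * n - j.+1)%N).
Proof.
rewrite mul2n -addnn big_split_ord big_split /=; congr (_ + _).
rewrite (reindex_inj rev_ord_inj) /=; apply: eq_bigr => -[j /= ltj] _.
by congr F; lia.
Qed.

Lemma prod_odd n : \prod_(j < n) (n%:R + 1 + j%:R) = \prod_(j < n) (2 * (2 * j%:R + 1)) :> rat.
Proof.
elim: n => [|n IH]; first by rewrite !big_ord0.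
have n1 : n%:R + 1 != 0 :> rat by nonzero.
apply: (mulfI n1); rewrite [in RHS]big_ord_recr /= -IH big_ord_recr /=.
have e : (n%:R + 1) * \prod_(j < n) (n.+1%:R + 1 + j%:R) =
    \prod_(j < n) (n%:R + 1 + j%:R) * (2 * n%:R + 1) :> rat.
  transitivity (\prod_(j < n.+1) (n%:R + 1 + j%:R) : rat).
    rewrite big_ord_recl /= addr0; congr (_ * _); apply: eq_bigr => j _.
    by rewrite /bump /= natrD -natr1; ring.
  by rewrite big_ord_recr /=; congr (_ * _); ring.
by rewrite [LHS]mulrA e; ring.
Qed.

Lemma signed_bin_prod n k :
  (- 1) ^+ k * 'C(n, k)%:R = \prod_(j < k) ((j%:R - n%:R) / (j%:R + 1)) :> rat.
Proof.
elim: k => [|k IH]; first by rewrite big_ord0 bin0 mulr1.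
rewrite big_ord_recr /= -IH exprS.
have k1 : k%:R + 1 != 0 :> rat by nonzero.
have e : (k%:R + 1) * 'C(n, k.+1)%:R = (n%:R - k%:R) * 'C(n, k)%:R :> rat.
  rewrite natr1 -natrM mul_bin_left natrM; have [le_kn|lt_nk] := leqP k n; first by rewrite natrB.
  by rewrite bin_small // !mulr0.
apply: (mulfI k1); rewrite mulrCA e; field.
by [].
Qed.

Section TruncatedSums.
Variables p m : nat.
Hypotheses (p_prime : prime p) (p_ge5 : (5 <= p)%N) (p_odd : p = (2 * m + 1)%N).
Local Notation Z := (p_integral p).
Local Notation pcong := (pcong p).
Local Notation punit := (punit p).

Let p_gt0 : (0 < p)%N. Proof. by lia. Qed.
Let pE : p%:R = 2 * m%:R + 1 :> rat. Proof. by rewrite p_odd natrD natrM. Qed.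
Let pZ : p%:R \in Z. Proof. exact: rpred_nat. Qed.

Lemma ndvd_small d : (0 < d < p)%N -> ~~ (p %| d)%N.
Proof. by case/andP=> d0 dp; rewrite gtnNdvd. Qed.

Lemma punit_small d : (0 < d < p)%N -> punit d%:R.
Proof. by move=> hd; apply: punit_nat => //; [case/andP: hd | exact: ndvd_small]. Qed.

Lemma punitS j : (j.+1 < p)%N -> punit (j%:R + 1).
Proof. by move=> hj; rewrite natr1; apply: punit_small. Qed.

Lemma punit_odd j : (j < p)%N -> j != m -> punit (2 * j%:R + 1).
Proof.
move=> jp jm; rewrite -natrM natr1; apply: punit_nat => //.
(* The number 2j + 1 is positive and below 2p, so its only possible multiple of p is p = 2m + 1
   itself. *)
apply/negP => /dvdnP[[|[|k]] e]; move: e; [lia| |nia].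
by move/eqP: jm; lia.
Qed.

Lemma integralS j : (j.+1 < p)%N -> (j%:R + 1)^-1 \in Z.
Proof. by case/punitS/and3P. Qed.

Lemma integral_odd j : (j < p)%N -> j != m -> (2 * j%:R + 1)^-1 \in Z.
Proof. by move=> jp /(punit_odd jp)/and3P[]. Qed.

Lemma punit2 : punit 2. Proof. by apply: punit_small; lia. Qed.
Lemma half_integral : 2^-1 \in Z. Proof. by case/and3P: punit2. Qed.

Lemma pcong_pD x z : z \in Z -> pcong 1 (x + p%:R * z) x.
Proof. by move=> hz; apply: (pcong_of p_gt0 hz); rewrite expr1. Qed.

(** * Harmonic sums modulo powers of p *)

Lemma mirror_inv2 d : (0 < d)%N -> (d < p)%N -> pcong 1 ((p%:R - d%:R) ^- 2) (d%:R ^- 2).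
Proof.
move=> d0 dp; have ud : punit d%:R by rewrite punit_small ?d0.
have c : pcong 1 ((p%:R - d%:R) ^+ 2) (d%:R ^+ 2).
  apply: (pcong_of p_gt0 (z := p%:R - 2 * d%:R)); last by ring.
  by rewrite rpredB // rpredM // rpred_nat.
apply: pcongV => //; last exact: punitX.
by apply: pcong_punit c _; last exact: punitX.
Qed.

Lemma harm2_fold : pcong 1 (harm2 (2 * m)) (2 * harm2 m).
Proof.
rewrite /harm2 (sum_fold _ (fun j => (j%:R + 1) ^- 2)) mulr_sumr.
apply: pcong_sum => -[j /= ltj] _; rewrite mulr2n mulrDl mul1r.
apply: pcongD; first exact: pcong_refl.
have -> : (2 * m - j.+1)%:R + 1 = p%:R - j.+1%:R :> rat by rewrite natrB ?pE ?natrM; [ring|lia].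
by rewrite natr1; apply: mirror_inv2; lia.
Qed.

(** The sum over all d < p is evaluated twice modulo p. Folding d to p - d gives twice the half sum;
    sending only the odd d to the even p - d gives 2/4 of it. The difference has coefficient 3/2, a
    unit for p >= 5. *)
Lemma harm2_half : pcong 1 (harm2 m) 0.
Proof.
have double : pcong 1 (harm2 (2 * m)) (2^-1 * harm2 m).
  rewrite /harm2 (sum_double _ (fun j => (j%:R + 1) ^- 2)) big_split /= mulr_sumr.
  rewrite (reindex_inj rev_ord_inj) -big_split /=.
  apply: pcong_sum => -[j /= ltj] _.
  have -> : (2 * (m - j.+1))%:R + 1 = p%:R - (2 * j.+1)%:R :> rat.
    by rewrite !natrM natrB ?pE; [ring|lia].
  apply: (pcong_trans (y := (2 * j.+1)%:R ^- 2 + ((2 * j).+1%:R + 1) ^- 2)).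
    by apply: pcongD; [apply: mirror_inv2; lia | exact: pcong_refl].
  rewrite [X in pcong 1 X _](_ : _ = 2^-1 * (j%:R + 1) ^- 2); first exact: pcong_refl.
  by field; nonzero.
have u3 : punit (3 / 2) by rewrite punitM ?punitV ?punit_small //; lia.
apply: (pcongI u3); rewrite mulr0.
have := pcong_trans (pcong_sym harm2_fold) double; rewrite !pcongE subr0.
by rewrite (_ : 2 * _ - _ = 3 / 2 * harm2 m) //; field.
Qed.

Lemma harm2_full : pcong 1 (harm2 (2 * m)) 0.
Proof.
apply: pcong_trans harm2_fold _; rewrite -(mulr0 2).
by apply: pcongMl harm2_half; exact: rpred_nat.
Qed.

Definition harm1 (n : nat) : rat := \sum_(j < n) (j%:R + 1)^-1.

(** Wolstenholme: 1/d + 1/(p-d) = p / (d (p-d)), and the cofactor of p is -1/d^2 modulo p, whose sum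
    vanishes. *)
Lemma harm1_full : pcong 2 (harm1 (2 * m)) 0.
Proof.
have e : 2 * harm1 (2 * m) = p%:R ^+ 1 * \sum_(j < 2 * m) (j%:R + 1)^-1 * (p%:R - (j%:R + 1))^-1.
  rewrite mulr2n mulrDl mul1r {2}/harm1 (reindex_inj rev_ord_inj) -big_split mulr_sumr /=.
  apply: eq_bigr => -[j /= ltj] _.
  have -> : (2 * m - j.+1)%:R + 1 = p%:R - (j%:R + 1) :> rat.
    by rewrite natrB ?pE ?natrM -?natr1; [ring|lia].
  have h1 : j%:R + 1 != 0 :> rat by nonzero.
  have h2 : p%:R - (j%:R + 1) != 0 :> rat by rewrite natr1 subr_eq0 eqr_nat; lia.
  by field; rewrite h1 h2.
apply: (pcongI punit2); rewrite mulr0 e -[X in pcong _ _ X](mulr0 (p%:R ^+ 1)).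
apply: (pcongMX p_gt0 1); apply: (pcong_trans (y := - harm2 (2 * m))); last first.
  by rewrite -oppr0; apply: pcongN harm2_full.
rewrite /harm2 -sumrN.
apply: pcong_sum => -[j /= ltj] _.
have uj : punit (j%:R + 1) by apply: punitS; lia.
have c : pcong 1 (p%:R - (j%:R + 1)) (- (j%:R + 1)).
  by rewrite addrC -{1}[p%:R]mulr1; apply: pcong_pD; exact: rpred1.
rewrite -exprVn expr2 -mulrN; apply: pcongMl; first by case/and3P: uj.
by rewrite -invrN; apply: pcongV => //; [apply: pcong_punit c _|]; rewrite ?punitN.
Qed.

(** * Morley's congruence *)

Definition morley_prod (x : rat) : rat := \prod_(j < m) (1 + p%:R * (x * (j%:R + 1)^-1)).

(** Both sides equal (-1)^m C(2m,m): on the left through (m+1)...(2m) over m!, on the right through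
    the product of the odd numbers below p. *)
Lemma morley_exact : morley_prod (- 1) = 4 ^+ m * morley_prod (- 2^-1).
Proof.
pose f : rat := \prod_(j < m) (j%:R + 1)^-1.
transitivity (f * \prod_(j < m) (- (m%:R + 1 + j%:R))).
  rewrite [X in _ * X](reindex_inj rev_ord_inj) -big_split /=.
  apply: eq_bigr => -[j /= ltj] _; rewrite pE natrB // -[j.+1%:R]natr1.
  by field; nonzero.
transitivity (f * \prod_(j < m) (- (2 * (2 * j%:R + 1)))); first by rewrite !prodrN prod_odd.
rewrite [X in _ * X](reindex_inj rev_ord_inj) -big_split /=.
rewrite (_ : 4 ^+ m = \prod_(j < m) 4); last by rewrite prodr_const card_ord.
rewrite -big_split /=; apply: eq_bigr => -[j /= ltj] _; rewrite pE natrB // -[j.+1%:R]natr1.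
by field; nonzero.
Qed.

Lemma harm1_integral n : (n < p)%N -> harm1 n \in Z.
Proof. by move=> ltn; rewrite rpred_sum // => -[j /= ltj] _; apply: integralS; lia. Qed.

(** In the expansion of the product the sum of squares is x^2 [harm2 m], divisible by p, so modulo
    p^3 only the exponential of p x [harm1 m], cut after degree 2, survives. *)
Lemma morley_prod_exp x : x \in Z ->
  pcong 3 (morley_prod x) (1 + p%:R * (x * harm1 m) + p%:R ^+ 2 * (x * harm1 m) ^+ 2 / 2).
Proof.
move=> xZ; have := @pcong_prod_lin p p_gt0 m (fun j => x * (j%:R + 1)^-1) half_integral.
rewrite -mulr_sumr -/(harm1 m) => h; apply: (pcong_trans (h _)).
  by move=> j ltj; rewrite rpredM // integralS; lia.
have -> : \sum_(i < m) (x / (i%:R + 1)) ^+ 2 = x ^+ 2 * harm2 m.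
  by rewrite mulr_sumr; apply: eq_bigr => i _; rewrite exprMn exprVn.
have [z zZ ez] : exists2 z, z \in Z & harm2 m = p%:R * z.
  have := harm2_half; rewrite !pcongE subr0 => /(pdvdP p_gt0)[z zZ ->].
  by exists z; rewrite ?expr1.
rewrite ez; apply: (pcong_of p_gt0 (z := - (x ^+ 2 * z / 2))); last by field.
by rewrite rpredN !rpredM ?rpredX ?half_integral.
Qed.

Lemma morley_prod_integral x : x \in Z -> morley_prod x \in Z.
Proof.
move=> xZ; rewrite rpred_prod // => -[j /= ltj] _.
by rewrite rpredD ?rpred1 // !rpredM // integralS; lia.
Qed.

(* Morley's congruence in the form prod_(0<j<=m) (1 + p/(2j)) = 4^-m modulo p^3: the product over
   1 + x p/j behaves like an exponential in x, and its values at -1 and -1/2 are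
   exactly in the ratio 4^m. *)
Lemma morley : pcong 3 (4 ^+ m * morley_prod 2^-1) 1.
Proof.
have hZ : harm1 m \in Z by apply: harm1_integral; lia.
have Z2 := half_integral; have Z2' : - 2^-1 \in Z by rewrite rpredN.
have N1 : -1 \in Z by rewrite rpredN rpred1.
have AZ := morley_prod_integral Z2; have BZ := morley_prod_integral Z2'.
have CZ : forall x, x \in Z ->
    1 + p%:R * (x * harm1 m) + p%:R ^+ 2 * (x * harm1 m) ^+ 2 / 2 \in Z.
  by move=> x xZ; rewrite !rpredD ?rpred1 // !(rpredM, rpredX).
have e1 : pcong 3 (morley_prod 2^-1 * morley_prod (- 2^-1)) 1.
  apply: pcong_trans (pcongM _ _ (morley_prod_exp Z2) (morley_prod_exp Z2')) _ => //;
    first exact: CZ.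
  apply: (pcong_of p_gt0 (z := p%:R * (2^-1 * harm1 m) ^+ 4 / 4)); last by field.
  rewrite (_ : _ / 4 = p%:R * (2^-1 * harm1 m) ^+ 4 * 2^-1 * 2^-1); last by field.
  by integral.
have e2 : pcong 3 (morley_prod (- 2^-1) ^+ 2) (morley_prod (- 1)).
  apply: pcong_trans _ (pcong_sym (morley_prod_exp N1)).
  apply: pcong_trans (pcongM _ _ (morley_prod_exp Z2') (morley_prod_exp Z2')) _ => //;
    first exact: CZ.
  apply: (pcong_of p_gt0 (z := - (2^-1 * harm1 m) ^+ 3 +
    p%:R * (2^-1 * harm1 m) ^+ 4 * 2^-1 * 2^-1)); last by field.
  by rewrite rpredD ?rpredN ?rpredM ?rpredX ?rpredM.
rewrite morley_exact in e2.
(* Multiplying by the square of [morley_prod 2^-1] replaces a cancellation of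
   [morley_prod (- 2^-1)]: the left side becomes the square of the product in [e1]. *)
have := pcongMl (rpredX 2 AZ) e2; rewrite -exprMn => e3.
have e4 := pcongM _ (rpred1 _) e1 e1; rewrite mulr1 -expr2 in e4.
have {}e4 := pcong_trans (pcong_sym (e4 _)) e3.
apply: pcong_sym; apply: pcong_trans (e4 _) _; first exact: rpredM.
have -> : morley_prod 2^-1 ^+ 2 * (4 ^+ m * morley_prod (- 2^-1)) =
  4 ^+ m * morley_prod 2^-1 * (morley_prod 2^-1 * morley_prod (- 2^-1)) by ring.
rewrite -[X in pcong _ _ X]mulr1; apply: pcongMl => //.
by rewrite rpredM ?rpredX ?rpred_nat.
Qed.

Lemma four_pow_cong1 : pcong 1 (4 ^+ m) 1.
Proof.
have := pcongW p_gt0 (isT : (1 <= 3)%N) morley => h.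
apply: pcong_trans h; apply: pcong_sym; rewrite -[X in pcong _ _ X]mulr1.
apply: pcongMl; first by rewrite rpredX ?rpred_nat.
rewrite [X in pcong _ _ X](_ : 1 = \prod_(j < m) (1 : rat)); last by rewrite big1.
apply: (pcong_prod p_gt0 (F := fun j => 1 + p%:R * (2^-1 / (j%:R + 1))) (G := fun _ => 1)) => j ltj.
  exact: rpred1.
by apply: pcong_pD; rewrite rpredM ?half_integral // integralS; lia.
Qed.

Let Z2 : 2^-1 \in Z := half_integral.

(** * The terms beyond the middle index *)

Definition trunc_ratio (j : nat) : rat :=
  (1 - p%:R / (j%:R + 1)) * (1 + p%:R / 2 / (j%:R + 1)) * (1 + p%:R / (2 * j%:R + 1)).

Lemma trunc_leg k :
  trunc_term p%:R k = leg_term (- 2^-1) k * \prod_(j < k) trunc_ratio j.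
Proof.
rewrite -big_split; apply: eq_bigr => j _ /=; rewrite /trunc_ratio.
by field; nonzero.
Qed.

Lemma trunc_ratio_cong j : (j.+1 < p)%N -> pcong 1 (trunc_ratio j) (if j == m then 2 else 1).
Proof.
move=> ltj; have aZ := integralS ltj; rewrite /trunc_ratio.
have h1 : pcong 1 ((1 - p%:R / (j%:R + 1)) * (1 + p%:R / 2 / (j%:R + 1))) 1.
  move: (_^-1) aZ => a aZ.
  apply: (pcong_of p_gt0 (z := - a / 2 - p%:R * a ^+ 2 / 2)); last by field.
  by integral.
rewrite -[X in pcong 1 _ X]mul1r; apply: pcongM => //.
- by integral.
- by case: ifP; rewrite ?rpred1 ?rpred_nat.
- case: eqVneq => [->|jm]; first by rewrite -pE divff ?pcong_refl // p_neq0.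
  by apply: pcong_pD; apply: integral_odd => //; lia.
Qed.

Lemma leg_half_pdvd k : (m < k)%N -> (k < p)%N -> leg_term (- 2^-1) k \in pdvd p 2.
Proof.
move=> mk kp; rewrite /leg_term (bigD1 (Ordinal mk)) //=.
apply: pdvd_mulr; last first.
  apply: rpred_prod => -[j /= ltj] _; rewrite -exprVn opprK.
  by integral; apply: integralS; lia.
apply/(pdvdP p_gt0); exists ((m%:R + 1)^-1 ^+ 2 * 2^-1 * 2^-1).
  by integral; apply: integralS; lia.
by rewrite pE; field; nonzero.
Qed.

(** For k > m the factor j = m puts (p/2)^2 into [leg_term (- 2^-1) k], so the remaining ratios
    count modulo p only. There each of them is 1, except the one at j = m, where 1 + p/(2m+1) =
    2. *)
Lemma trunc_upper k : (m < k)%N -> (k < p)%N ->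
  pcong 3 (trunc_term p%:R k) (2 * leg_term (- 2^-1) k).
Proof.
move=> mk kp; rewrite trunc_leg [2 * _]mulrC !pcongE -mulrBr.
apply: (@pdvdM p 2 1); first exact: leg_half_pdvd.
have := @pcong_prod p p_gt0 1 k trunc_ratio (fun j => if j == m then 2 else 1).
have -> : \prod_(j < k) (if j == m :> nat then 2 else 1) = 2 :> rat.
  rewrite (bigD1 (Ordinal mk)) //= eqxx big1 ?mulr1 // => j.
  by rewrite -val_eqE /= => /negPf ->.
apply=> j ltj; last by apply: trunc_ratio_cong; lia.
by case: ifP; rewrite ?rpred1 ?rpred_nat.
Qed.

(** Term ratio of the Chu-Vandermonde sum with upper parameters -m and 1/2 + p and lower parameter 1
    + p/2; it agrees with the term ratio of [trunc_term p%:R] modulo p^2. *)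
Definition vandermonde_factor (j : nat) : rat :=
  (j%:R - m%:R) / (j%:R + 1) * ((2^-1 + p%:R + j%:R) / (1 + p%:R / 2 + j%:R)).

Definition vandermonde_term (k : nat) : rat := \prod_(j < k) vandermonde_factor j.

Lemma vandermonde_sum : \sum_(k < m.+1) vandermonde_term k = (- 1) ^+ m / morley_prod 2^-1.
Proof.
rewrite (eq_bigr (fun k : 'I_m.+1 => (- 1) ^+ k * 'C(m, k)%:R *
    \prod_(j < k) ((2^-1 + p%:R + j%:R) / (1 + p%:R / 2 + j%:R)))); last first.
  by move=> k _; rewrite signed_bin_prod -big_split.
rewrite chu_vandermonde; last by move=> j _; nonzero.
rewrite big_split /= [X in X * _](reindex_inj rev_ord_inj) /= -big_split /=.
rewrite -prodfV.
rewrite (_ : (- 1) ^+ m = \prod_(j < m) (- 1)); last by rewrite prodr_const card_ord.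
rewrite -big_split; apply: eq_bigr => -[j /= ltj] _; rewrite natrB // pE.
field; nonzero.
Qed.

Lemma sign_integral n : (- 1) ^+ n \in Z.
Proof. by integral. Qed.

Lemma vandermonde_sum_cong : pcong 3 (\sum_(k < m.+1) vandermonde_term k) ((- 1) ^+ m * 4 ^+ m).
Proof.
rewrite vandermonde_sum; apply: pcongMl; first exact: sign_integral.
have u4 : punit (4 ^+ m) by apply: punitX; apply: punit_small; lia.
have := morley; set A := morley_prod _ => h.
have uA : punit (4 ^+ m * A).
  by apply: (pcong_punit p_prime (pcongW p_gt0 _ h)) => //; exact: punit1.
have := pcongMl (proj1 (andP u4)) (pcongV uA (punit1 _) h).
by rewrite invr1 mulr1 invfM mulrA divff ?mul1r //; case/and3P: u4.
Qed.

Definition vandermonde_corr (j : nat) : rat := 2 * (2 * j%:R + 1) ^- 2 - 3 / 4 * (j%:R + 1) ^- 2.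

Definition odd_harm2 (n : nat) : rat := \sum_(j < n) (2 * j%:R + 1) ^- 2.

Lemma vandermonde_corr_sum k : \sum_(j < k) vandermonde_corr j = 2 * odd_harm2 k - 3 / 4 * harm2 k.
Proof. by rewrite sumrB -!mulr_sumr. Qed.

Definition vandermonde_ratio (j : nat) : rat :=
  (1 - p%:R / (j%:R + 1)) * (1 + p%:R / 2 / (j%:R + 1)) ^+ 2 *
  ((1 + p%:R / (2 * j%:R + 1)) / ((1 - p%:R / (2 * j%:R + 1)) * (1 + 2 * p%:R / (2 * j%:R + 1)))).

Lemma trunc_vandermonde k : (k <= m)%N ->
  trunc_term p%:R k = vandermonde_term k * \prod_(j < k) vandermonde_ratio j.
Proof.
move=> km; rewrite -big_split; apply: eq_bigr => -[j /= ltj] _.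
rewrite /vandermonde_ratio /vandermonde_factor.
have h : 2 * j%:R + 1 - p%:R != 0 :> rat by rewrite -natrM natr1 subr_eq0 eqr_nat; lia.
have -> : j%:R - m%:R = (2 * j%:R + 1 - p%:R) / 2 :> rat by rewrite pE; field.
field; rewrite h; nonzero.
Qed.

Let odd_integral j : (j < m)%N -> (2 * j%:R + 1)^-1 \in Z.
Proof. by move=> jm; apply: integral_odd; lia. Qed.

Lemma vandermonde_corr_integral j : (j < m)%N -> vandermonde_corr j \in Z.
Proof.
move=> jm; have aZ : (j%:R + 1)^-1 \in Z by apply: integralS; lia.
have bZ := odd_integral jm.
rewrite /vandermonde_corr -!exprVn (_ : 3 / 4 = 3 * 2^-1 * 2^-1 :> rat) //.
by integral.
Qed.

(** With a and b the inverses of j + 1 and 2j + 1, the linear terms cancel separately in (1 - pa)(1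
    + pa/2)^2 and in (1 + pb) / ((1 - pb)(1 + 2pb)); their p^2-coefficients are -3/4 a^2 and 2
    b^2. *)
Lemma vandermonde_ratio_cong j : (j < m)%N ->
  pcong 3 (vandermonde_ratio j) (1 + p%:R ^+ 2 * vandermonde_corr j).
Proof.
move=> jm; have aZ : (j%:R + 1)^-1 \in Z by apply: integralS; lia.
have bZ := odd_integral jm.
rewrite /vandermonde_ratio /vandermonde_corr -!exprVn.
move: ((j%:R + 1)^-1) ((2 * j%:R + 1)^-1) aZ bZ => a b aZ bZ.
pose D := (1 - p%:R * b) * (1 + 2 * p%:R * b).
have Du : punit D.
  have c : pcong 1 D 1.
    apply: (pcong_of p_gt0 (z := b - 2 * p%:R * b ^+ 2)); last by rewrite /D; ring.
    by integral.
  exact: (pcong_punit p_prime c (punit1 p)).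
have /and3P[DZ DV D0] := Du.
rewrite -/D; have D1 : 1 + p%:R * b - 2 * p%:R ^+ 2 * b ^+ 2 = D by rewrite /D; ring.
have e1 : (1 + p%:R * b) / D = 1 + 2 * p%:R ^+ 2 * b ^+ 2 + p%:R ^+ 3 *
    (2 * b ^+ 2 * (- b + 2 * p%:R * b ^+ 2) / D).
  have -> : 1 + p%:R * b = D + 2 * p%:R ^+ 2 * b ^+ 2 by rewrite -D1; ring.
  have -> : - b + 2 * p%:R * b ^+ 2 = (1 - D) / p%:R by rewrite -D1; field; rewrite p_neq0.
  by field; rewrite D0 p_neq0.
rewrite e1; set w := 2 * b ^+ 2 * _ / D.
have wZ : w \in Z by rewrite /w; integral.
pose v : rat := - 3 * 2^-1 * 2^-1 * a ^+ 2 - p%:R * a ^+ 3 * 2^-1 * 2^-1.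
have vZ : v \in Z by rewrite /v; integral.
have e2 : (1 - p%:R * a) * (1 + p%:R / 2 * a) ^+ 2 = 1 + p%:R ^+ 2 * v by rewrite /v; field.
rewrite e2.
apply: (pcong_of p_gt0 (z := w - a ^+ 3 * 2^-1 * 2^-1 + p%:R * v * (2 * b ^+ 2 + p%:R * w))).
  by integral.
by rewrite /v; field.
Qed.

Lemma leg_nat_integral k : (k < p)%N -> leg_term m%:R k \in Z.
Proof.
move=> kp; apply: rpred_prod => -[j /= ltj] _; rewrite -exprVn.
by integral; apply: integralS; lia.
Qed.

Lemma leg_half_integral k : (k < p)%N -> leg_term (- 2^-1) k \in Z.
Proof.
move=> kp; apply: rpred_prod => -[j /= ltj] _; rewrite -exprVn opprK.
by integral; apply: integralS; lia.
Qed.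

Lemma vandermonde_term_cong k : (k <= m)%N -> pcong 1 (vandermonde_term k) (leg_term m%:R k).
Proof.
move=> km; apply: (pcong_prod p_gt0 (F := vandermonde_factor)
  (G := fun j => (j%:R - m%:R) * (j%:R + 1 + m%:R) / (j%:R + 1) ^+ 2)) => j ltj.
  rewrite -exprVn.
  by integral; apply: integralS; lia.
have uj : punit (j%:R + 1) by apply: punitS; lia.
have c1 : pcong 1 (1 + p%:R / 2 + j%:R) (j%:R + 1).
  by apply: (pcong_of p_gt0 Z2); ring.
have c2 : pcong 1 (2^-1 + p%:R + j%:R) (j%:R + 1 + m%:R).
  by apply: (pcong_of p_gt0 Z2); rewrite pE; field.
have u1 := pcong_punit p_prime c1 uj.
have /and3P[jZ jV j0] := uj; have /and3P[_ lV _] := u1.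
rewrite /vandermonde_factor [X in pcong _ _ X](_ : _ = (j%:R - m%:R) / (j%:R + 1) *
   ((j%:R + 1 + m%:R) / (j%:R + 1))); last by field; nonzero.
apply: pcongMl; first by integral.
apply: pcongM => //; last exact: pcongV.
by integral.
Qed.

Lemma trunc_lower k : (k <= m)%N ->
  pcong 3 (trunc_term p%:R k)
    (vandermonde_term k + p%:R ^+ 2 * (leg_term m%:R k * (2 * odd_harm2 k - 3 / 4 * harm2 k))).
Proof.
move=> km; rewrite trunc_vandermonde // -vandermonde_corr_sum.
have cZ : vandermonde_term k \in Z.
  by apply: (pcong_integral p_gt0 (vandermonde_term_cong km)); apply: leg_nat_integral; lia.
have sZ : \sum_(j < k) vandermonde_corr j \in Z.
  by apply: rpred_sum => -[j /= ltj] _; apply: vandermonde_corr_integral; lia.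
apply: (pcong_trans (y := vandermonde_term k * (1 + p%:R ^+ 2 * \sum_(j < k) vandermonde_corr j))).
  apply: pcongMl => //; apply: (pcong_prod_sqr p_gt0) => j ltj.
    by apply: vandermonde_corr_integral; lia.
  by apply: vandermonde_ratio_cong; lia.
rewrite mulrDr mulr1 mulrCA; apply: pcongD; first exact: pcong_refl.
apply: (pcongMX p_gt0 2 (m := 1)); rewrite mulrC [X in pcong _ _ X]mulrC.
by apply: pcongMl => //; exact: vandermonde_term_cong.
Qed.

Lemma odd_harm2_integral k : (k <= m)%N -> odd_harm2 k \in Z.
Proof.
move=> km; apply: rpred_sum => -[j /= ltj] _.
by rewrite -exprVn; apply: p_integralX; apply: odd_integral; lia.
Qed.

(** Since m + 1/2 = p/2, the numerator (j - m)(j + 1 + m) is (j + 1/2)^2 - (p/2)^2: the two terms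
    differ by factors 1 - p^2/(2j+1)^2, without a part of order p. *)
Lemma leg_half_lower k : (k <= m)%N ->
  pcong 3 (leg_term (- 2^-1) k) (leg_term m%:R k + p%:R ^+ 2 * (leg_term m%:R k * odd_harm2 k)).
Proof.
move=> km; have aZ : leg_term (- 2^-1) k \in Z by apply: leg_half_integral; lia.
have oZ := odd_harm2_integral km.
have e : leg_term m%:R k =
    leg_term (- 2^-1) k * \prod_(j < k) (1 - p%:R ^+ 2 * (2 * j%:R + 1) ^- 2).
  rewrite -big_split; apply: eq_bigr => -[j /= ltj] _; rewrite pE.
  by field; nonzero.
have h : pcong 3 (leg_term m%:R k) (leg_term (- 2^-1) k * (1 - p%:R ^+ 2 * odd_harm2 k)).
  rewrite e; apply: pcongMl => //; rewrite -mulrN -sumrN.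
  apply: (pcong_prod_sqr p_gt0 (F := fun j => 1 - p%:R ^+ 2 * (2 * j%:R + 1) ^- 2)
    (c := fun j => - (2 * j%:R + 1) ^- 2)) => j ltj.
    by rewrite -exprVn; apply: p_integralN; apply: p_integralX; apply: odd_integral; lia.
  by rewrite mulrN; exact: pcong_refl.
have h1 : pcong 1 (leg_term (- 2^-1) k) (leg_term m%:R k).
  apply: pcong_sym; apply: (pcong_trans (pcongW p_gt0 _ h)) => //.
  apply: (pcong_of p_gt0 (z := - (leg_term (- 2^-1) k * (p%:R * odd_harm2 k)))); last by ring.
  by integral.
apply: (pcong_trans (y := leg_term m%:R k + p%:R ^+ 2 * (leg_term (- 2^-1) k * odd_harm2 k))).
  apply: pcong_sym; rewrite !pcongE.
  suff -> : leg_term m%:R k + p%:R ^+ 2 * (leg_term (- 2^-1) k * odd_harm2 k) -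
      leg_term (- 2^-1) k =
    leg_term m%:R k - leg_term (- 2^-1) k * (1 - p%:R ^+ 2 * odd_harm2 k) by [].
  by ring.
apply: pcongD; first exact: pcong_refl.
apply: (pcongMX p_gt0 2 (m := 1)); rewrite mulrC [X in pcong _ _ X]mulrC.
exact: pcongMl.
Qed.

(** * The sum of all the a_k *)

Let pS : p = (2 * m).+1. Proof. by rewrite p_odd addn1. Qed.

Let leg_sum_pS x : leg_sum p x = leg_sum (2 * m).+1 x. Proof. by rewrite -pS. Qed.

Lemma sin_prod_center : pcong 2 (sin_prod (2 * m) (- p%:R / 2)) 1.
Proof.
rewrite [X in pcong _ _ X](_ : 1 = \prod_(j < 2 * m) (1 : rat)); last by rewrite big1.
apply: (pcong_prod p_gt0 (F := fun j => 1 - (- p%:R / 2) ^+ 2 / (j%:R + 1) ^+ 2)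
  (G := fun _ => 1)) => j ltj; first exact: p_integral1.
have aZ : (j%:R + 1)^-1 \in Z by apply: integralS; lia.
rewrite -exprVn; apply: (pcong_of p_gt0 (z := - ((j%:R + 1)^-1 ^+ 2 * 2^-1 * 2^-1))).
  by integral.
by field; nonzero.
Qed.

(** Every term after the first has the factor p/2, so its [sin_prod] may be replaced by 1, its value
    modulo p^2. What is left is p/2 times [harm1] minus p^2/4 times [harm2], and both vanish by the
    Wolstenholme congruences. *)
Lemma leg_sum_center : pcong 3 (leg_sum p (- p%:R / 2)) 1.
Proof.
rewrite leg_sum_pS /leg_sum big_ord_recl {1}/leg_term big_ord0 /= -[X in pcong _ _ X]addr0.
apply: pcongD; first exact: pcong_refl.
have pd : p%:R / 2 \in pdvd p 1.
  by apply: pdvd_mulr => //; rewrite -{1}[p%:R]expr1; exact: pdvdX.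
apply: (pcong_trans (y := p%:R / 2 * harm1 (2 * m) - (p%:R / 2) ^+ 2 * harm2 (2 * m))).
  rewrite /harm1 /harm2 !mulr_sumr -sumrB; apply: pcong_sum => -[j /= ltj] _.
  rewrite /bump /= add1n leg_termS.
  have aZ : (j%:R + 1)^-1 \in Z by apply: integralS; lia.
  set f := sin_prod _ _.
  have fc : pcong 2 f 1.
    rewrite /f [X in pcong _ _ X](_ : 1 = \prod_(i < j) (1 : rat)); last by rewrite big1.
    apply: (pcong_prod p_gt0 (F := fun i => 1 - (- p%:R / 2) ^+ 2 / (i%:R + 1) ^+ 2)
      (G := fun _ => 1)) => i lti; first exact: p_integral1.
    have bZ : (i%:R + 1)^-1 \in Z by apply: integralS; lia.
    rewrite -exprVn; apply: (pcong_of p_gt0 (z := - ((i%:R + 1)^-1 ^+ 2 * 2^-1 * 2^-1))).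
      by integral.
    by field; nonzero.
  rewrite [X in pcong _ _ X](_ :
    _ = p%:R / 2 * ((j%:R + 1)^-1 - p%:R / 2 * (j%:R + 1)^-1 ^+ 2) * 1);
    last by field; nonzero.
  rewrite [X in pcong _ X _](_ :
    _ = p%:R / 2 * ((j%:R + 1)^-1 - p%:R / 2 * (j%:R + 1)^-1 ^+ 2) * f);
    last by field; nonzero.
  rewrite !pcongE -mulrBr; apply: (@pdvdM p 1 2) => //.
  by apply: pdvd_mulr => //; integral.
rewrite -[X in pcong _ _ X]subr0; apply: pcongD.
  have := harm1_full; rewrite !pcongE !subr0 => h.
  exact: (@pdvdM p 1 2).
apply: pcongN; have := harm2_full; rewrite !pcongE !subr0 => h.
rewrite expr2; apply: (@pdvdM p 2 1) => //.
exact: (@pdvdM p 1 1).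
Qed.

(* The recursion [sin_prod_shift] transports the value at the centre -p/2 to r - p/2. *)
Lemma sin_prod_cong r : (r < m)%N ->
  pcong 3 (sin_prod (2 * m) (- p%:R / 2 + r.+1%:R)) (- (p%:R ^+ 2 / 4 * r.+1%:R ^- 2)).
Proof.
have Z4 : 4^-1 \in Z by rewrite (_ : 4^-1 = 2^-1 * 2^-1 :> rat) //; integral.
pose f r := sin_prod (2 * m) (- p%:R / 2 + r%:R).
(* The right-hand side of the recursion has the factor r^2 - p^2/4, which is not a unit at r = 0;
   keeping it inside the invariant treats the step from the centre like all the others. *)
pose P r := pcong 3 ((r%:R ^+ 2 - p%:R ^+ 2 / 4) * f r) (- (p%:R ^+ 2 / 4)).
have step i : (i < m)%N -> P i -> pcong 3 (f i.+1) (- (p%:R ^+ 2 / 4 * i.+1%:R ^- 2)).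
  move=> im Pi; pose D := (i.+1%:R - p%:R / 2) * (i.+1%:R - 3 / 2 * p%:R) : rat.
  have DE : D * f i.+1 = (i%:R ^+ 2 - p%:R ^+ 2 / 4) * f i.
    have := sin_prod_shift (2 * m) (- p%:R / 2 + i%:R).
    rewrite -addrA [i%:R + 1]natr1 -/(f i) -/(f i.+1).
    rewrite (_ : (2 * m)%:R = p%:R - 1); last by rewrite pE natrM addrK.
    move=> e; transitivity (- ((- p%:R / 2 + i.+1%:R) * (p%:R - 1 - (- p%:R / 2 + i%:R)) * f i.+1)).
      by rewrite /D -[i.+1%:R]natr1; field.
    by rewrite e; field.
  have ui : punit (i.+1%:R ^+ 2) by apply: punitX; apply: punit_small; lia.
  have c : pcong 1 D (i.+1%:R ^+ 2).
    apply: (pcong_of p_gt0 (z := - (2 * i.+1%:R) + 3 * 2^-1 * 2^-1 * p%:R));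
      last by rewrite /D; field.
    by integral.
  have uD := pcong_punit p_prime c ui; have /and3P[_ DV D0] := uD.
  have -> : f i.+1 = D^-1 * ((i%:R ^+ 2 - p%:R ^+ 2 / 4) * f i) by rewrite -DE mulKf.
  apply: pcong_trans (pcongMl DV Pi) _; rewrite mulrC mulNr; apply: pcongN.
  rewrite -!(mulrA (p%:R ^+ 2)).
  apply: (pcongMX p_gt0 2 (m := 1)); apply: pcongMl => //.
  exact: pcongV.
have PP i : (i <= m)%N -> P i.
  elim: i => [|i IH] im.
    rewrite /P expr0n sub0r mulNr; apply: pcongN; rewrite -[X in pcong _ _ X]mulr1.
    rewrite -!(mulrA (p%:R ^+ 2)); apply: (pcongMX p_gt0 2 (m := 1)); apply: pcongMl => //.
    by rewrite /f addr0; apply: (pcongW p_gt0 _ sin_prod_center).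
  have h := step i im (IH (ltnW im)).
  have /and3P[_ iV i0] : punit (i.+1%:R) by apply: punit_small; lia.
  apply: pcong_trans (pcongMl _ h) _; first by integral.
  apply: (pcong_of p_gt0 (z := p%:R * 4^-1 * 4^-1 * i.+1%:R^-1 ^+ 2)); first by integral.
  by field; nonzero.
by move=> rm; apply: step => //; apply: PP; exact: ltnW.
Qed.

Lemma leg_sum_half_cong :
  pcong 3 (leg_sum p (- 2^-1)) ((- 1) ^+ m - p%:R ^+ 2 / 2 * ((- 1) ^+ m * alt_harm2 m)).
Proof.
have -> : - 2^-1 = - p%:R / 2 + m%:R :> rat by rewrite pE; field.
rewrite leg_sum_pS leg_sum_shift -leg_sum_pS; apply: pcongD.
  rewrite -[X in pcong _ _ X]mulr1; apply: pcongMl; last exact: leg_sum_center.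
  exact: sign_integral.
have -> : - (p%:R ^+ 2 / 2 * ((- 1) ^+ m * alt_harm2 m)) =
    2 * \sum_(i < m) (- 1) ^+ (m - i.+1) * - (p%:R ^+ 2 / 4 * i.+1%:R ^- 2).
  rewrite /alt_harm2 !mulr_sumr -sumrN; apply: eq_bigr => -[i /= im] _.
  have -> : (- 1) ^+ m = (- 1) ^+ (m - i.+1) * (- 1) ^+ i.+1 :> rat by rewrite -exprD subnK.
  have s2 : (- 1) ^+ i.+1 * (- 1) ^+ i.+1 = 1 :> rat by rewrite -expr2 sqrr_sign.
  move: ((- 1) ^+ i.+1) ((- 1) ^+ (m - i.+1)) s2 => s t s2.
  transitivity (- (p%:R ^+ 2 / 2 * (t * (s * s) * (i%:R + 1) ^- 2))); first by ring.
  by rewrite s2; field; nonzero.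
apply: pcongMl; first exact: p_integral_nat.
apply: pcong_sum => -[i /= im] _; apply: pcongMl; first exact: sign_integral.
exact: sin_prod_cong.
Qed.

Lemma trunc_sum_cong :
  pcong 3 (\sum_(k < p) trunc_term p%:R k)
    ((- 1) ^+ m * 4 ^+ m + p%:R ^+ 2 / 2 * ((- 1) ^+ m * alt_harm2 m)).
Proof.
(* Subtracting 2 a_k for every k, not just for k > m, also cancels the [odd_harm2] corrections of
   the lower terms: they enter twice in both [trunc_lower] and 2 a_k. *)
pose F k := trunc_term p%:R k - 2 * leg_term (- 2^-1) k.
have upper : pcong 3 (\sum_(k < p) F k) (\sum_(k < m.+1) F k).
  rewrite [X in pcong _ _ X](big_ord_widen p F) /=; last by lia.
  rewrite [X in pcong _ _ X]big_mkcond; apply: pcong_sum => -[k /= kp] _.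
  rewrite ltnS; case: leqP => mk; first exact: pcong_refl.
  by have := trunc_upper mk kp; rewrite !pcongE subr0.
pose L k : rat := leg_term m%:R k.
have lower : pcong 3 (\sum_(k < m.+1) F k)
    (\sum_(k < m.+1) (vandermonde_term k - 2 * L k - p%:R ^+ 2 * (3 / 4) * (harm2 k * L k))).
  apply: pcong_sum => -[k /= km] _.
  apply: pcong_trans (pcongD (trunc_lower km)
    (pcongN (pcongMl (p_integral_nat _ 2) (leg_half_lower km)))) _.
  rewrite [X in pcong _ X _](_ : _ = vandermonde_term k - 2 * L k
    - p%:R ^+ 2 * (3 / 4) * (harm2 k * L k)).
    exact: pcong_refl.
  by rewrite -/(L k); ring.
have -> : \sum_(k < p) trunc_term p%:R k = \sum_(k < p) F k + 2 * leg_sum p (- 2^-1).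
  by rewrite sumrB -mulr_sumr subrK.
apply: pcong_trans (pcongD (pcong_trans upper lower)
  (pcongMl (p_integral_nat _ 2) leg_sum_half_cong)) _.
rewrite !sumrB -!mulr_sumr -/(leg_sum m.+1 m%:R) leg_sum_nat // leg_harm_nat //.
(* The contributions 2 (-1)^m cancel. The coefficients of p^2 (-1)^m [alt_harm2 m] are 3/2 from the
   harmonic weights and -1 from the sum of the a_k. *)
rewrite [X in pcong _ X _](_ : _ = \sum_(k < m.+1) vandermonde_term k +
   p%:R ^+ 2 / 2 * ((- 1) ^+ m * alt_harm2 m)); last by field.
by apply: pcongD; [exact: vandermonde_sum_cong | exact: pcong_refl].
Qed.

End TruncatedSums.

(** * Euler numbers *)

Lemma euler_convolution s :
  \sum_(j < s.+1) 'C(s, j)%:R * euler_number j * (1 + (- 1) ^+ (s - j)) =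
  if s == 0%N then 2 else 0 :> rat.
Proof.
have := euler_gf s; rewrite /fps_mul (reindex_inj rev_ord_inj) /= => e.
transitivity (s`!%:R * fps_const 2 s); last first.
  by case: s {e} => [|s] /=; rewrite ?mulr0 ?fact0 ?mul1r.
rewrite -e mulr_sumr; apply: eq_bigr => -[j /= ltj] _.
rewrite subSS subKn // /fps_add /fps_exp expr1n.
have -> : 'C(s, j)%:R = s`!%:R / (j`!%:R * (s - j)`!%:R) :> rat.
  by rewrite -[X in 'C(X, _)](subnK (_ : j <= s)%N) // bin_fact_rat subnK.
by field; rewrite !fact_neq0.
Qed.

Lemma euler_rec s : euler_number s = (s == 0%N)%:R - 2^-1 *
  \sum_(j < s) 'C(s, j)%:R * euler_number j * (1 + (- 1) ^+ (s - j)).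
Proof.
have := euler_convolution s; rewrite big_ord_recr /= binn subnn expr0.
by case: (s == 0%N) => /= e; lra.
Qed.

Lemma euler_odd s : odd s -> euler_number s = 0.
Proof.
elim/ltn_ind: s => s IH os; rewrite euler_rec big1 => [|j _].
  by case: s os {IH} => //= s _; rewrite mulr0 subr0.
have [oj|ej] := boolP (odd j); first by rewrite IH // mulr0 mul0r.
by rewrite -signr_odd oddB ?(ltnW (ltn_ord j)) // os (negbTE ej) /= expr1 subrr mulr0.
Qed.

Lemma euler_integral p s : 2^-1 \in p_integral p -> euler_number s \in p_integral p.
Proof.
move=> Z2; elim/ltn_ind: s => s IH; rewrite euler_rec.
apply: p_integralD; first exact: p_integral_nat.
apply: p_integralN; apply: p_integralM => //; apply: rpred_sum => j _.
by have := IH j (ltn_ord j) => h; integral.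
Qed.

(* 2^n times the usual Euler polynomial at (t+1)/2. *)
Definition euler_poly (n : nat) (t : rat) : rat :=
  \sum_(j < n.+1) 'C(n, j)%:R * euler_number j * t ^+ (n - j).

Lemma euler_polyD n t : euler_poly n (t + 1) + euler_poly n (t - 1) = 2 * t ^+ n.
Proof.
(* Collecting by the power of t with C(n,j) C(n-j,s-j) = C(n,s) C(s,j) turns the inner sums into
   [euler_convolution], which leaves s = 0 alone. *)
pose G j s : rat := 'C(n, s)%:R * t ^+ (n - s) *
     ('C(s, j)%:R * euler_number j * (1 + (- 1) ^+ (s - j))).
transitivity (\sum_(j < n.+1) \sum_(s < n.+1 | (j <= s)%N) G j s).
  rewrite -big_split /=; apply: eq_bigr => -[j /= ltj] _.
  rewrite -mulrDr !exprDn -big_split /= mulr_sumr.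
  rewrite -(big_geq_mkord j n.+1 xpredT (G j)) -(add0n j) big_addn big_mkord add0n -subSn //.
  apply: eq_bigr => -[i /= lti] _; rewrite /G addnK expr1n.
  have -> : (n - (i + j) = n - j - i)%N by lia.
  have e : 'C(n, i + j)%:R * 'C(i + j, j)%:R = 'C(n, j)%:R * 'C(n - j, i)%:R :> rat.
    have [k ->] : exists k, n = (k + (i + j))%N by exists (n - (i + j))%N; lia.
    rewrite !bin_fact_rat addnA addnK -addnA.
    rewrite (_ : k + (i + j) = k + i + j)%N ?addnA // !bin_fact_rat.
    by field; rewrite !fact_neq0.
  transitivity ('C(n, j)%:R * 'C(n - j, i)%:R * euler_number j *
      (t ^+ (n - j - i) * (1 + (- 1) ^+ i))).
    by ring.
  by rewrite -e; ring.
rewrite (exchange_big_dep xpredT) //= big_ord_recl [X in _ + X]big1 ?addr0 => [|s _].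
  rewrite (big_pred1 ord0) => [|i]; last by rewrite /= -val_eqE /= leqn0.
  by rewrite /G /= !bin0 !subn0 euler_rec big_ord0 /= expr0; ring.
rewrite /G lift0 -mulr_sumr.
under eq_bigl do rewrite -ltnS.
rewrite -(big_ord_widen n.+1 (fun j =>
  'C(s.+1, j)%:R * euler_number j * (1 + (- 1) ^+ (s.+1 - j)))) ?ltnS //.
by rewrite euler_convolution mulr0.
Qed.

Lemma euler_poly1 n : ~~ odd n -> (0 < n)%N -> euler_poly n 1 = 0.
Proof.
move=> en n0; have := euler_convolution n; rewrite (gtn_eqF n0) => e.
have : 2 * euler_poly n 1 = 0.
  rewrite -e mulr_sumr; apply: eq_bigr => -[j /= ltj] _; rewrite expr1n.
  have [oj|ej] := boolP (odd j); first by rewrite euler_odd // !(mulr0, mul0r).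
  by rewrite -signr_odd oddB // (negbTE en) (negbTE ej) expr0; ring.
by move=> h; lra.
Qed.

(** Iterating [euler_polyD] at the even points 2, 4, ..., 2m, starting from the zero at 1. The
    endpoint 2m + 1 will be p. *)
Lemma euler_poly_odd n m : ~~ odd n -> (0 < n)%N ->
  euler_poly n (2 * m%:R + 1) = 2 * (- 1) ^+ m * \sum_(r < m) (- 1) ^+ r.+1 * (2 * r.+1%:R) ^+ n.
Proof.
move=> en n0; elim: m => [|m IH]; first by rewrite big_ord0 !mulr0 add0r euler_poly1.
have := euler_polyD n (2 * m.+1%:R).
rewrite (_ : 2 * m.+1%:R - 1 = 2 * m%:R + 1); last by rewrite -natr1; ring.
rewrite IH big_ord_recr /= => e.
have {}e : euler_poly n (2 * m.+1%:R + 1) = 2 * (2 * m.+1%:R) ^+ n -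
  2 * (- 1) ^+ m * \sum_(r < m) (- 1) ^+ r.+1 * (2 * r.+1%:R) ^+ n by rewrite -e addrK.
have s2 : (- 1) ^+ m * (- 1) ^+ m = 1 :> rat by rewrite -expr2 sqrr_sign.
rewrite e [(- 1) ^+ m.+1]exprS.
move: ((- 1) ^+ m) s2 ((2 * m.+1%:R) ^+ n) (\sum_(r < m) _) => s s2 w z.
by transitivity (2 * w * (s * s) - 2 * s * z); [rewrite s2 mulr1 | ring].
Qed.

Section EulerCongruence.
Variables p m : nat.
Hypotheses (p_prime : prime p) (p_ge5 : (5 <= p)%N) (p_odd : p = (2 * m + 1)%N).
Local Notation Z := (p_integral p).
Local Notation pcong := (pcong p).

Let p_gt0 : (0 < p)%N. Proof. by lia. Qed.

Lemma fermat_inv2 r : (0 < r < p)%N -> pcong 1 (r%:R ^+ (p - 3)) (r%:R ^- 2).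
Proof.
move=> /andP[r0 rp]; have pr : ~~ (p %| r)%N by rewrite gtnNdvd.
have /and3P[rZ rV rn0] : punit p r%:R by exact: punit_nat.
have le_rp : (r <= r ^ p)%N by rewrite -{1}[r]expn1 leq_pexp2l.
have : (p %| r ^ p - r)%N by rewrite -eqn_mod_dvd //; apply/eqP/fermat_little.
case/dvdnP=> q eq.
have e : r%:R ^+ (p - 3) * r%:R ^+ 3 = r%:R + p%:R * q%:R :> rat.
  rewrite -exprD subnK; last by lia.
  by rewrite -natrX -natrM mulnC -eq natrB // addrC subrK.
have r3 : r%:R ^+ 3 != 0 :> rat by rewrite expf_neq0.
apply: (pcong_of p_gt0 (z := q%:R * r%:R^-1 ^+ 3)); first by integral.
by apply: (mulIf r3); rewrite e; field; exact: rn0.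
Qed.

(** At t = p the polynomial reduces modulo p to its constant term, the Euler number; on the other
    side Fermat turns (2r)^(p-3) into 1/(2r)^2, as 2r < p. *)
Lemma euler_cong : pcong 1 (euler_number (p - 3)) (2^-1 * ((- 1) ^+ m * alt_harm2 m)).
Proof.
have /and3P[_ Z2 _] : punit p 2 by apply: punit_nat => //; rewrite gtnNdvd //; lia.
have en : ~~ odd (p - 3) by rewrite p_odd; apply/negP; lia.
have n0 : (0 < p - 3)%N by lia.
have := euler_poly_odd m en n0; rewrite (_ : 2 * m%:R + 1 = p%:R :> rat); last first.
  by rewrite p_odd natrD natrM.
move=> e.
have c1 : pcong 1 (euler_poly (p - 3) p%:R) (euler_number (p - 3)).
  rewrite /euler_poly big_ord_recr /= binn subnn expr0 mulr1 mul1r.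
  rewrite -[X in pcong _ _ X]add0r; apply: pcongD; last exact: pcong_refl.
  rewrite !pcongE subr0; apply: rpred_sum => -[j /= ltj] _.
  rewrite -(subnSK ltj) exprS mulrCA; apply: pdvd_mulr.
    by rewrite -[p%:R]expr1; exact: pdvdX.
  by have := euler_integral j Z2 => h; integral.
apply: pcong_trans (pcong_sym c1) _; rewrite e /alt_harm2 -mulrA !mulr_sumr.
apply: pcong_sum => -[r /= rm] _.
have Z4 : 2 * (- 1) ^+ m * (- 1) ^+ r.+1 \in Z by integral.
rewrite [X in pcong _ _ X](_ : _ = 2 * (- 1) ^+ m * (- 1) ^+ r.+1 * (2 * r.+1)%:R ^- 2); last first.
  by field; nonzero.
rewrite !mulrA -natrM; apply: pcongMl => //; apply: fermat_inv2; lia.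
Qed.

End EulerCongruence.

Theorem theorem1p1 (p : nat) (p_prime : prime p) (p_ge5 : (5 <= p)%N) :
  p_congruent p (p ^ 4)
    (\sum_(0 <= k < p) (3 * k + 1)%:R / (- 32) ^+ k * (Domb k)%:R)
    ((- 1) ^+ ((p - 1) %/ 2) * p%:R + p%:R ^+ 3 * euler_number (p - 3)).
Proof.
have [m p_odd] : exists m, p = (2 * m + 1)%N.
  exists p./2; have := odd_double_half p; case: (even_prime p_prime) => [|->]; lia.
have p_gt0 : (0 < p)%N by lia.
have -> : ((p - 1) %/ 2 = m)%N by lia.
have Z2 := half_integral p_prime p_ge5 p_odd.
have EZ := euler_integral (p - 3) Z2.
have u4 : punit p (4 ^+ m) by apply: punitX; apply: punit_small => //; lia.
have /and3P[_ V4 n4] := u4.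
set y := (X in p_congruent _ _ _ X); set x := (X in p_congruent _ _ X _).
have yZ : y \in p_integral p by rewrite /y; integral.
have xE : x = p%:R ^+ 1 * ((4 ^+ m)^-1 * \sum_(k < p) trunc_term p%:R k).
  rewrite /x big_mkord Domb_sum // mulrA; congr (_ * _).
  rewrite {2}p_odd exprD exprM (_ : (- 2) ^+ 2 = 4 :> rat) //.
  by rewrite expr1 -mulf_div divff // mulr1.
have inner : pcong p 3 ((4 ^+ m)^-1 * \sum_(k < p) trunc_term p%:R k)
    ((- 1) ^+ m + p%:R ^+ 2 * euler_number (p - 3)).
  apply: pcong_trans (pcongMl V4 (trunc_sum_cong p_prime p_ge5 p_odd)) _.
  rewrite mulrDr mulrCA mulVf // mulr1; apply: pcongD; first exact: pcong_refl.
  rewrite [X in pcong _ _ X _](_ : _ = p%:R ^+ 2 *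
     ((4 ^+ m)^-1 * (2^-1 * ((- 1) ^+ m * alt_harm2 m)))); last by ring.
  (* The correction already carries p^2, so 4^-m matters only modulo p, where it is 1. *)
  apply: (pcongMX p_gt0 2 (m := 1)); rewrite -[euler_number _]mul1r; apply: pcongM => //.
    rewrite -invr1; apply: pcongV => //; first exact: punit1.
    exact: (four_pow_cong1 p_prime p_ge5 p_odd).
  exact/pcong_sym/(euler_cong p_prime p_ge5 p_odd).
have xy : pcong p 4 x y.
  have := pcongMX p_gt0 1 inner; rewrite -xE.
  by rewrite (_ : p%:R ^+ 1 * _ = y) //; rewrite /y; ring.
split=> //; first exact: pcong_integral xy yZ.
by have /(pdvdP p_gt0)[z zZ ->] := xy; exists z; rewrite ?natrX.
Qed.
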